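(* Let $\Gamma$ be a connected finite simplicial graph and let $H$ be a finitely generated malnormal subgroup of the right-angled Coxeter group $G_\Gamma$. Then $H$ is strongly quasiconvex in $G_\Gamma$. Moreover, if $H$ is a proper subgroup of $G_\Gamma$, then $H$ is virtually free (and therefore $H$ is also stable in $G_\Gamma$).
   Context: Right-angled Coxeter group: for a finite simplicial graph $\Gamma$ with vertex set $S$, $G_\Gamma$ is the group generated by $S$ with relations $s^2=1$ for all $s\in S$ and $st=ts$ whenever $s,t$ are adjacent vertices. Malnormal: a subgroup $H\le G$ is malnormal if $gHg^{-1}\cap H$ is trivial for each $g\in G\setminus H$. A $(K,C)$-quasi-geodesic in a metric space $Y$ is a map $f\colon I\to Y$ from a subinterval $I$ of $\mathbb{R}$ or $\mathbb{Z}$ with $\frac1K|s-t|-C\le d(f(s),f(t))\le K|s-t|+C$ for all $s,t\in I$. Quasi-geodesics in a finitely generated group $G$ are taken in the Cayley graph with respect to a finite generating set. Strongly quasiconvex: a subgroup $H$ of a finitely generated group $G$ is strongly quasiconvex if for every $K\ge1$, $C\ge0$ there is $M=M(K,C)$ such that every $(K,C)$-quasi-geodesic in $G$ with endpoints on $H$ is contained in the $M$-neighborhood of $H$. Stable: a finitely generated subgroup $H$ of $G$ is stable if $H$ is undistorted in $G$ (the inclusion is a quasi-isometric embedding for word metrics) and for any $K\ge1$, $L\ge0$ there is $M=M(K,L)\ge0$ such that any pair of $(K,L)$-quasi-geodesics in $G$ with common endpoints in $H$ have Hausdorff distance at most $M$. *)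

(* Defs.v *)
From HB Require Import structures.
From mathcomp Require Import all_boot all_order all_algebra generic_quotient.
From mathcomp Require Import all_classical all_reals all_analysis.

Set Implicit Arguments.
Unset Strict Implicit.
Unset Printing Implicit Defensive.

Import Order.TTheory GRing.Theory Num.Theory.
Local Open Scope classical_set_scope.

(* A letter (b, x) stands for x if b = false and for the formal inverse of x  *)
(* if b = true; a relation (u, v) stands for the equation u = v.              *)
Definition gword (T : Type) := seq (bool * T).
Definition inv_letter (T : Type) (l : bool * T) : bool * T := (~~ l.1, l.2).
Definition inv_word (T : Type) (w : gword T) : gword T :=
  rev (map (@inv_letter T) w).

Inductive word_eq (T : Type) (rels : set (gword T * gword T)) :
    gword T -> gword T -> Prop :=
| word_eq_refl u : word_eq rels u u
| word_eq_sym u v : word_eq rels u v -> word_eq rels v u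
| word_eq_trans u v w : word_eq rels u v -> word_eq rels v w -> word_eq rels u w
| word_eq_cancel u v l : word_eq rels (u ++ [:: l; inv_letter l] ++ v) (u ++ v)
| word_eq_rel u v r : rels r -> word_eq rels (u ++ r.1 ++ v) (u ++ r.2 ++ v).

Section PresentedGroup.
Variables (T : choiceType) (rels : set (gword T * gword T)).
Implicit Types u v w : gword T.

Definition word_eqb : rel (seq (bool * T)) := fun u v => `[< word_eq rels u v >].

Lemma word_eqb_refl : reflexive word_eqb.
Proof. by move=> u; apply/asboolP; exact: word_eq_refl. Qed.

Lemma word_eqb_sym : symmetric word_eqb.
Proof. by move=> u v; apply/asboolP/asboolP; exact: word_eq_sym. Qed.

Lemma word_eqb_trans : transitive word_eqb.
Proof.
by move=> v u w /asboolP uv /asboolP vw; apply/asboolP; exact: word_eq_trans vw.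
Qed.

Canonical word_equiv := EquivRel word_eqb word_eqb_refl word_eqb_sym
  word_eqb_trans.

Definition presented_group : Type := {eq_quot word_equiv}%qT.

HB.instance Definition _ :=
  Choice.copy presented_group {eq_quot word_equiv}%qT.

Definition pclass (w : gword T) : presented_group := \pi_({eq_quot word_equiv})%qT w.
Definition prepr (x : presented_group) : gword T := repr (x : {eq_quot word_equiv}%qT).

Lemma preprK x : pclass (prepr x) = x.
Proof. exact: reprK. Qed.

Lemma pclassP u v : pclass u = pclass v <-> word_eq rels u v.
Proof.
split; first by move=> /eqquotP/asboolP.
by move=> uv; apply/eqquotP/asboolP.
Qed.

Lemma prepr_pclass u : word_eq rels (prepr (pclass u)) u.
Proof. by apply/pclassP; rewrite preprK. Qed.

Lemma word_eq_cat u u' v v' :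
  word_eq rels u u' -> word_eq rels v v' -> word_eq rels (u ++ v) (u' ++ v').
Proof.
move=> uu' vv'; apply: (@word_eq_trans _ _ _ (u' ++ v)).
- elim: uu' => {u u'}.
  + by move=> u; exact: word_eq_refl.
  + by move=> u u' _; exact: word_eq_sym.
  + by move=> u u' u'' _ ? _; exact: word_eq_trans.
  + by move=> u u' l; rewrite -!catA; exact: word_eq_cancel.
  + by move=> u u' r rr; rewrite -!catA; exact: word_eq_rel.
- elim: vv' => {v v'}.
  + by move=> v; exact: word_eq_refl.
  + by move=> v v' _; exact: word_eq_sym.
  + by move=> v v' v'' _ ? _; exact: word_eq_trans.
  + by move=> v v' l; rewrite !(catA u'); exact: word_eq_cancel.
  + by move=> v v' r rr; rewrite !(catA u' v); exact: word_eq_rel.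
Qed.

Lemma inv_letterK : involutive (@inv_letter T).
Proof. by case=> b x; rewrite /inv_letter negbK. Qed.

Lemma inv_wordK : involutive (@inv_word T).
Proof.
move=> w; rewrite /inv_word map_rev revK -map_comp -[RHS]map_id.
by apply: eq_map => l; exact: inv_letterK.
Qed.

Lemma word_eq_catV u : word_eq rels (u ++ inv_word u) [::].
Proof.
elim: u => [|l u IHu]; first exact: word_eq_refl.
rewrite /inv_word /= rev_cons -cats1 -/(inv_word u) catA.
apply: (@word_eq_trans _ _ _ ([:: l] ++ [::] ++ [:: inv_letter l])).
- apply: (@word_eq_cat [:: l] [:: l]); first exact: word_eq_refl.
  exact: word_eq_cat IHu (word_eq_refl _ _).
- exact: (word_eq_cancel rels [::] [::] l).
Qed.

Lemma word_eq_Vcat u : word_eq rels (inv_word u ++ u) [::].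
Proof. by rewrite -{2}[u]inv_wordK; exact: word_eq_catV. Qed.

Lemma word_eq_inv u v :
  word_eq rels u v -> word_eq rels (inv_word u) (inv_word v).
Proof.
move=> uv; apply: (@word_eq_trans _ _ _ (inv_word u ++ v ++ inv_word v)).
  rewrite -[X in word_eq _ X _]cats0; apply: word_eq_cat (word_eq_refl _ _) _.
  exact/word_eq_sym/word_eq_catV.
rewrite catA -[X in word_eq _ _ X]cat0s.
apply: word_eq_cat (word_eq_refl _ _).
apply: word_eq_trans (word_eq_Vcat u).
by apply: word_eq_cat (word_eq_refl _ _) _; exact: word_eq_sym.
Qed.

Definition pone : presented_group := pclass [::].
Definition pinv (x : presented_group) := pclass (inv_word (prepr x)).
Definition pmul (x y : presented_group) := pclass (prepr x ++ prepr y).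

Lemma pmulE u v : pmul (pclass u) (pclass v) = pclass (u ++ v).
Proof. by apply/pclassP/word_eq_cat; exact: prepr_pclass. Qed.

Lemma pinvE u : pinv (pclass u) = pclass (inv_word u).
Proof. exact/pclassP/word_eq_inv/prepr_pclass. Qed.

Lemma pmulA : associative pmul.
Proof.
by move=> x y z; rewrite -[x]preprK -[y]preprK -[z]preprK !pmulE catA.
Qed.

Lemma pmul1 : left_id pone pmul.
Proof. by move=> x; rewrite -[x]preprK pmulE. Qed.

Lemma pmulr1 : right_id pone pmul.
Proof. by move=> x; rewrite -[x]preprK pmulE cats0. Qed.

Lemma pmulV : left_inverse pone pinv pmul.
Proof.
by move=> x; rewrite -[x]preprK pinvE pmulE; exact/pclassP/word_eq_Vcat.
Qed.

Lemma pmulVr : right_inverse pone pinv pmul.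
Proof.
by move=> x; rewrite -[x]preprK pinvE pmulE; exact/pclassP/word_eq_catV.
Qed.

HB.instance Definition _ :=
  isGroup.Build presented_group pmulA pmul1 pmulr1 pmulV pmulVr.

End PresentedGroup.

Definition free_group (I : choiceType) := presented_group (@set0 (gword I * gword I)).
HB.instance Definition _ (I : choiceType) := Group.on (free_group I).

Definition racg_rels (T : finType) (e : rel T) : set (gword T * gword T) :=
  [set r | (exists s, r = ([:: (false, s); (false, s)], [::])) \/
           (exists s t, e s t /\
              r = ([:: (false, s); (false, t)], [:: (false, t); (false, s)]))].

Definition racg (T : finType) (e : rel T) := presented_group (racg_rels e).
HB.instance Definition _ (T : finType) (e : rel T) := Group.on (racg e).

Section GroupNotions.
Variable G : groupType.
Local Open Scope group_scope.
Implicit Types (A B : set G) (g h : G) (H F : groupClosed G).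

Definition has_word_of_length A g (n : nat) : Prop :=
  exists w : seq G, [/\ size w = n,
    (forall x, x \in w -> A x \/ A x^-1) & \prod_(x <- w) x = g].

Definition generates A B : Prop :=
  B = [set g | exists n, has_word_of_length A g n].

Definition finitely_generated B : Prop :=
  exists A, finite_set A /\ generates A B.

(* The value is meaningful only for g in the subgroup generated by A.         *)
Definition word_length A g : nat :=
  xget 0%N [set n | has_word_of_length A g n /\
                    forall m, has_word_of_length A g m -> (n <= m)%N].

Definition word_dist A g h : nat := word_length A (g^-1 * h).

Definition malnormal H : Prop := forall g, g \notin H ->
  [set g * h * g^-1 | h in [set` H]] `&` [set` H] = [set 1].

Definition is_free H : Prop :=
  exists (I : choiceType) (f : free_group I -> G),
    [/\ {morph f : x y / x * y}, injective f & range f = [set` H]].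

Definition finite_index F H : Prop :=
  finite_set [set [set h * x | x in [set` F]] | h in [set` H]].

Definition virtually_free H : Prop :=
  exists F, [/\ {subset F <= H}, finite_index F H & is_free F].

End GroupNotions.

Section Metric.
Variables (R : realType) (Y : Type) (d : Y -> Y -> R).
Local Open Scope ring_scope.

Definition RZ_interval (I : set R) : Prop :=
  is_interval I \/
  exists J : set R, is_interval J /\ I = J `&` range (fun n : int => n%:~R).

(* Only the restriction of f to I matters.                                    *)
Definition quasi_geodesic (K C : R) (I : set R) (f : R -> Y) : Prop :=
  RZ_interval I /\
  forall s t, I s -> I t ->
    K^-1 * `|s - t| - C <= d (f s) (f t) <= K * `|s - t| + C.

Definition endpoints (I : set R) (a b : R) : Prop :=
  [/\ I a, I b & forall t, I t -> a <= t <= b].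

Definition neighborhood (M : R) (B : set Y) : set Y :=
  [set p | exists2 q, B q & d p q <= M].

Definition hausdorff_dist (B1 B2 : set Y) : \bar R :=
  ereal_inf [set r%:E | r in [set r : R | [/\ 0 <= r,
    B1 `<=` neighborhood r B2 & B2 `<=` neighborhood r B1]]].

End Metric.

Section CayleyGraph.
Variables (R : realType) (G : groupType) (A : set G).
Local Open Scope ring_scope.

(* The geometric realization of the (simplicial) Cayley graph, whose edges    *)
(* have length 1: the point of the edge {src, dst} at distance pos from src,  *)
(* or the vertex src if src = dst. A point of the graph may have several      *)
(* such representations; these are at cayley_dist 0 from each other.          *)
Record cayley_point := CayleyPoint {
  src : G;
  dst : G;
  pos : R;
  _ : src = dst \/ A (src^-1 * dst)%g \/ A (dst^-1 * src)%g;
  _ : 0 <= pos <= 1 }.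

Definition edge_length (p : cayley_point) : R := (src p != dst p)%:R.
Definition to_src p : R := pos p * edge_length p.
Definition to_dst p : R := (1 - pos p) * edge_length p.

(* On one edge, the distance along that edge; otherwise a shortest path from  *)
(* p to q leaves the edge of p and enters the edge of q at an endpoint.       *)
Definition cayley_dist (p q : cayley_point) : R :=
  let D g h : R := (word_dist A g h)%:R in
  if (src p == src q) && (dst p == dst q) then
    `|to_src p - to_src q|
  else if (src p == dst q) && (dst p == src q) then
    `|to_src p - to_dst q|
  else Num.min
    (Num.min (to_src p + D (src p) (src q) + to_src q)
             (to_src p + D (src p) (dst q) + to_dst q))
    (Num.min (to_dst p + D (dst p) (src q) + to_src q)
             (to_dst p + D (dst p) (dst q) + to_dst q)).

Lemma vertex_pos : 0 <= (0 : R) <= 1.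
Proof. by rewrite lexx ler01. Qed.

Definition vertex (g : G) : cayley_point :=
  CayleyPoint (or_introl (erefl g)) vertex_pos.

Definition at_vertex (p : cayley_point) (g : G) : Prop :=
  cayley_dist p (vertex g) = 0.

Lemma cayley_dist_vertex g h :
  cayley_dist (vertex g) (vertex h) = (word_dist A g h)%:R.
Proof.
rewrite /cayley_dist /to_src /to_dst /edge_length /= !eqxx.
rewrite !mulr0 !addr0 !add0r !minxx oppr0 normr0 andbb.
suff D0 : word_dist A g g = 0%N.
  by case: eqVneq => [<-|_]; rewrite ?D0 //; case: ifP.
rewrite /word_dist mulVg /word_length.
case: xgetP => [n _ [_ /(_ 0%N) n0]|/(_ 0%N) []].
  have : (n <= 0)%N by apply: n0; exists [::]; split => //; rewrite big_nil.
  by rewrite leqn0 => /eqP ->.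
by split => //; exists [::]; split => //; rewrite big_nil.
Qed.

End CayleyGraph.

Section Subgroups.
Variables (R : realType) (G : groupType).
Local Open Scope ring_scope.
Implicit Types (A : set G) (H : groupClosed G).

Definition strongly_quasiconvex H : Prop :=
  forall A, finite_set A -> generates A setT ->
  forall K C : R, 1 <= K -> 0 <= C ->
  exists M : R, forall (I : set R) (f : R -> cayley_point R A) (a b : R) (g h : G),
    quasi_geodesic (@cayley_dist R G A) K C I f -> endpoints I a b ->
    g \in H -> h \in H -> at_vertex (f a) g -> at_vertex (f b) h ->
    f @` I `<=` neighborhood (@cayley_dist R G A) M
                  [set vertex R A x | x in [set` H]].

Definition undistorted H : Prop :=
  forall A B, finite_set A -> generates A setT ->
    finite_set B -> generates B [set` H] ->
  exists K C : R, [/\ 1 <= K, 0 <= C &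
    forall x y, x \in H -> y \in H ->
      K^-1 * (word_dist B x y)%:R - C <= (word_dist A x y)%:R
        <= K * (word_dist B x y)%:R + C].

Definition stable H : Prop :=
  [/\ finitely_generated [set` H], undistorted H &
  forall A, finite_set A -> generates A setT ->
  forall K L : R, 1 <= K -> 0 <= L ->
  exists M : R, 0 <= M /\
  forall (I1 I2 : set R) (f1 f2 : R -> cayley_point R A) (a1 b1 a2 b2 : R) (g h : G),
    quasi_geodesic (@cayley_dist R G A) K L I1 f1 -> endpoints I1 a1 b1 ->
    quasi_geodesic (@cayley_dist R G A) K L I2 f2 -> endpoints I2 a2 b2 ->
    g \in H -> h \in H ->
    at_vertex (f1 a1) g -> at_vertex (f2 a2) g ->
    at_vertex (f1 b1) h -> at_vertex (f2 b2) h ->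
    (hausdorff_dist (@cayley_dist R G A) (f1 @` I1) (f2 @` I2) <= M%:E)%E].

End Subgroups.

(* So the quantifications over finite generating sets above are not vacuous.  *)
Lemma racg_finitely_generated (T : finType) (e : rel T) :
  finitely_generated [set: racg e].
Proof.
pose gen (l : bool * T) : racg e := pclass (racg_rels e) [:: l].
exists (range (fun s => gen (false, s))); split; first exact/finite_image/finite_finset.
apply/seteqP; split=> // x _; exists (size (prepr x)), (map gen (prepr x)).
split; first by rewrite size_map.
- move=> _ /mapP[[[] s] _ ->]; [right|left]; exists s => //.
  by rewrite /gen [RHS]pinvE.
- rewrite big_map -[RHS]preprK; elim: (prepr x) => [|l w IHw].
    by rewrite big_nil.
  by rewrite big_cons IHw [LHS]pmulE.
Qed.

(* Main.v *)
(* If a proper malnormal subgroup H contained a reflection, connectedness would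
   put conjugates of all the generators into H. So H contains no reflection,
   and since it contains the centralizers of its nontrivial elements, it acts
   freely on the walls of the Cayley graph and meets the conjugates of the join
   subgroups trivially.

   Freeness: inside the cosets of the subgroups generated by final segments of
   the vertex set, choose H-equivariantly one edge dual to each wall. These
   edges form an H-invariant spanning tree of the Cayley graph.

   Quasiconvexity: a word geodesic p of H crosses a given wall only within a
   time window of bounded length, because H is free on the walls. If some wall
   U crossed many of the walls separating the endpoints of p, the pigeonhole
   principle would give a nontrivial element of H in a conjugate of a join
   subgroup. So p crosses, at bounded intervals, nested walls no consecutive
   two of which are crossed by a common wall. A geodesic that crosses two such
   walls passes near p in between, and a quasi-geodesic staying far from p over
   many of these pairs would be too long. *)

Require Import Defs.
From mathcomp Require Import all_boot all_order all_algebra generic_quotient.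
From mathcomp Require Import all_classical all_reals all_analysis.
From mathcomp Require Import zify lra.

Set Implicit Arguments.
Unset Strict Implicit.
Unset Printing Implicit Defensive.

Import Order.TTheory GRing.Theory Num.Theory.
Local Open Scope group_scope.

(** The geometry is read off the cocycle [crosses]: lengths, halfspaces and medians are all
    determined by which walls separate two elements. Malnormality enters as [H_cent] and [H_refl];
    together they say that a nontrivial element of [H] commutes with no reflection.

    The final segments of the vertex order make the tree argument inductive. Reaching the chosen
    edge of a wall of type [s] takes letters of higher rank only, which gives connectedness, and a
    closed path can be cut at a letter of least rank. That the chosen edges form a tree is expressed
    as the triviality of the holonomy of closed paths for every edge labelling. Labels in the free
    group on the edges leaving a fundamental subtree then make the holonomy an inverse of the
    evaluation map.

    In the pigeonhole argument, the repeated data must force a join. They record the types of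
    transverse walls met so far and still to come, so that a wall seen between the two times can be
    replaced by one of the same type elsewhere along [p]. These replacements produce the adjacencies
    that split an element of [H] into two commuting factors. *)

Ltac gsimp := rewrite ?(conjgE, invgM, invgK, invg1, mulgA, mul1g, mulg1);
  rewrite ?(mulgK, mulgVK, mulgV, mulVg, mulg1, mul1g).

(* The field [gen_lift] says that the listed relations present G: involutions of
   X satisfying them extend to an action of G. *)
Record coxeter_presentation (T : finType) (e : rel T) (G : groupType) := {
  gen :> T -> G;
  gen_sqr : forall s, gen s * gen s = 1;
  gen_comm : forall s t, e s t -> gen s * gen t = gen t * gen s;
  gen_words : forall g, exists w : seq T, g = \prod_(s <- w) gen s;
  gen_lift : forall (X : Type) (f : T -> X -> X),
    (forall s x, f s (f s x) = x) ->
    (forall s t x, e s t -> f s (f t x) = f t (f s x)) ->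
    exists F : G -> X -> X, [/\ forall x, F 1 x = x,
      forall g h x, F (g * h) x = F g (F h x) & forall s x, F (gen s) x = f s x] }.

(** * Walls in a right-angled Coxeter group *)

Section Walls.
Variables (T : finType) (e : rel T).
Hypotheses (e_sym : symmetric e) (e_irr : irreflexive e).
Variables (G : groupType) (S : coxeter_presentation e G).
Implicit Types (s t : T) (w : seq T) (r g h x y z : G).

Definition ev w : G := \prod_(s <- w) S s.

Lemma ev_nil : ev [::] = 1. Proof. by rewrite /ev big_nil. Qed.
Lemma ev_cons s w : ev (s :: w) = S s * ev w. Proof. by rewrite /ev big_cons. Qed.
Lemma ev_cat w1 w2 : ev (w1 ++ w2) = ev w1 * ev w2.
Proof. by rewrite /ev big_cat. Qed.
Lemma ev1 s : ev [:: s] = S s. Proof. by rewrite ev_cons ev_nil mulg1. Qed.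
Lemma ev_rcons w s : ev (rcons w s) = ev w * S s.
Proof. by rewrite -cats1 ev_cat ev1. Qed.

Lemma genV s : (S s)^-1 = S s.
Proof. by apply: (mulgI (S s)); rewrite mulgV gen_sqr. Qed.

Lemma genK s : involutive (fun g => S s * g).
Proof. by move=> g; rewrite mulgA gen_sqr mul1g. Qed.

Lemma genKr s g : g * S s * S s = g.
Proof. by rewrite -mulgA gen_sqr mulg1. Qed.

Lemma ev_rev w : ev (rev w) = (ev w)^-1.
Proof.
elim: w => [|s w IH]; first by rewrite ev_nil invg1.
by rewrite rev_cons ev_rcons IH ev_cons invgM genV.
Qed.

(** A generator conjugates the reflection and flips the sign exactly when that reflection is its
    own. [conj_eq] holds for generators that are equal or commute: conjugation by one does not
    change the test against the other, so the relations are respected. *)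
Lemma crossing_lift : exists F : G -> G * bool -> G * bool,
  [/\ forall p, F 1 p = p, forall g h p, F (g * h) p = F g (F h p)
    & forall s p, F (S s) p = (p.1 ^ S s, p.2 (+) (p.1 == S s))].
Proof.
have conj_eq u v (q : G) : S u * S v * S u = S v -> (q ^ S u == S v) = (q == S v).
  by move=> uvu; rewrite (can2_eq (conjgK _) (conjgKV _)) conjgE invgK genV mulgA uvu.
apply: gen_lift => [s [r b]|s t [r b] est] /=.
  by rewrite -conjgM gen_sqr conjg1 conj_eq ?genKr // -addbA addbb addbF.
have st := gen_comm S est.
by rewrite !conj_eq; [rewrite addbAC -!conjgM st|rewrite st genKr|rewrite -st genKr].
Qed.

(* The cocycle [crosses r g]: the parity of the number of times a path from 1
   to g in the Cayley graph crosses the wall of the reflection r; it is false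
   if r is not a reflection. *)
Definition crosses r g : bool := (projT1 (cid crossing_lift) g^-1 (r, false)).2.

Lemma crosses_mul r g h : crosses r (g * h) = crosses r g (+) crosses (r ^ g) h.
Proof.
rewrite /crosses; case: cid => F /= [F1 FM Fs].
(* The sign added by [g0] does not depend on the sign already present; this is what turns the action
   into a cocycle. *)
have Fg g0 : forall p, F g0^-1 p = (p.1 ^ g0, p.2 (+) (F g0^-1 (p.1, false)).2).
  have [w ->] := gen_words S g0; rewrite -/(ev w); elim: w => [|s w IH] [q b].
    by rewrite ev_nil invg1 F1 conjg1 F1 /= addbF.
  rewrite ev_cons invgM !FM !genV !Fs IH /=.
  by rewrite [in RHS]IH /= conjgM addbA; congr pair.
rewrite invgM FM; set b := (F g^-1 _).2.
have -> : F g^-1 (r, false) = (r ^ g, b) by rewrite Fg.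
by rewrite [in LHS]Fg.
Qed.

Lemma crosses_gen r s : crosses r (S s) = (r == S s).
Proof. by rewrite /crosses; case: cid => F /= [F1 FM Fs]; rewrite genV Fs. Qed.

Lemma crosses1 r : crosses r 1 = false.
Proof.
by have := crosses_mul r 1 1; rewrite mulg1 conjg1; case: (crosses r 1).
Qed.

Lemma gen_neq1 s : S s != 1.
Proof.
apply/eqP => s1; have := crosses_gen (S s) s.
by rewrite eqxx {2}s1 crosses1.
Qed.

(** * Letter parities and the types of walls *)

Lemma parity_lift t : exists F : G -> bool -> bool,
  [/\ forall b, F 1 b = b, forall g h b, F (g * h) b = F g (F h b)
    & forall s b, F (S s) b = b (+) (s == t)].
Proof.
by apply: gen_lift => [s b|s s' b _]; [rewrite -addbA addbb addbF|rewrite addbAC].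
Qed.

Definition parity t g : bool := projT1 (cid (parity_lift t)) g false.

Lemma parityM t g h : parity t (g * h) = parity t g (+) parity t h.
Proof.
rewrite /parity; case: cid => F /= [F1 FM Fs].
have Fg g0 : forall b, F g0 b = F g0 false (+) b.
  have [w ->] := gen_words S g0; rewrite -/(ev w); elim: w => [|s w IH] b.
    by rewrite ev_nil !F1.
  by rewrite ev_cons !FM !Fs IH addbAC.
by rewrite FM Fg.
Qed.

Lemma parity_gen t s : parity t (S s) = (s == t).
Proof. by rewrite /parity; case: cid => F /= [F1 FM Fs]; rewrite Fs. Qed.

Lemma parity1 t : parity t 1 = false.
Proof. by have := parityM t 1 1; rewrite mulg1; case: (parity t 1). Qed.

Lemma parityV t g : parity t g^-1 = parity t g.
Proof.
have := parityM t g^-1 g; rewrite mulVg parity1.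
by case: (parity t g^-1); case: (parity t g).
Qed.

Lemma parityJ t g h : parity t (g ^ h) = parity t g.
Proof. by rewrite conjgE !parityM parityV addbCA addbb addbF. Qed.

(** Distinct generators are not conjugate, so all edges dual to a wall carry the same letter, the
    type of the wall. *)
Lemma parity_refl t s g : parity t (S s ^ g) = (s == t).
Proof. by rewrite parityJ parity_gen. Qed.

Lemma gen_inj : injective S.
Proof.
move=> s t st; apply/eqP.
by rewrite -(parity_gen t s) st parity_gen.
Qed.

(** * Reduced words, length and separating walls *)

Fixpoint walls w : seq G :=
  if w is s :: w' then S s :: [seq r ^ S s | r <- walls w'] else [::].

Lemma size_walls w : size (walls w) = size w.
Proof. by elim: w => //= s w IH; rewrite size_map IH. Qed.

Lemma walls_cat w1 w2 :
  walls (w1 ++ w2) = walls w1 ++ [seq r ^ (ev w1)^-1 | r <- walls w2].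
Proof.
elim: w1 => [|s w1 IH] /=.
  by rewrite ev_nil invg1 (eq_map (@conjg1 G)) map_id.
rewrite IH map_cat -map_comp; congr (_ :: _ ++ _).
by apply: eq_map => r /=; rewrite ev_cons invgM genV conjgM.
Qed.

Lemma crosses_ev r w : crosses r (ev w) = odd (count_mem r (walls w)).
Proof.
elim: w r => [|s w IH] r; first by rewrite ev_nil crosses1.
rewrite ev_cons crosses_mul crosses_gen IH /= oddD oddb eq_sym; congr (_ (+) odd _).
rewrite count_map; apply: eq_count => q /=.
by rewrite (can2_eq (conjgK _) (conjgKV _)) genV.
Qed.

Lemma wallsP r w : r \in walls w ->
  exists w1 s w2, w = w1 ++ s :: w2 /\ r = S s ^ (ev w1)^-1.
Proof.
elim: w r => //= s w IH r; rewrite inE => /orP[/eqP->|/mapP[q /IH[w1 [t [w2 [-> ->]]]] ->]].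
  by exists [::], s, w; rewrite ev_nil invg1 conjg1.
by exists (s :: w1), t, w2; rewrite ev_cons invgM genV conjgM.
Qed.

Lemma wall_delete w1 s w2 :
  S s ^ (ev w1)^-1 * ev (w1 ++ s :: w2) = ev (w1 ++ w2).
Proof.
by rewrite !ev_cat ev_cons conjgE invgK !mulgA mulgVK genKr.
Qed.

(** Deletion: if the path meets the wall of a letter again, reflecting the stretch in between
    removes both letters. *)
Lemma shorten w : ~~ uniq (walls w) ->
  exists w', [/\ (size w' < size w)%N, ev w' = ev w & {subset w' <= w}].
Proof.
elim: w => //= s w IH; rewrite negb_and negbK map_inj_uniq; last exact: conjg_inj.
case/orP => [/mapP[r rw sr]|/IH[w' [sw' ew' subw']]]; last first.
  exists (s :: w'); split; rewrite ?ev_cons ?ew' //.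
  move=> x; rewrite !inE => /orP[->//|/subw' ->]; exact: orbT.
have {sr}rs : r = S s.
  by apply: (conjg_inj (S s)); rewrite -sr conjgE mulKg.
have [w1 [t [w2 [ww r_def]]]] := wallsP rw.
exists (w1 ++ w2); split; last 2 first.
- by rewrite ev_cons ww -(wall_delete w1 t w2) -r_def rs.
- by move=> x; rewrite ww mem_cat !inE mem_cat !inE => /orP[]->; rewrite ?orbT.
by rewrite ww !size_cat /=; lia.
Qed.

Definition reduced w : bool := uniq (walls w).

Lemma reduced_sub w : exists w', [/\ reduced w', ev w' = ev w & {subset w' <= w}].
Proof.
have [n] := ubnP (size w); elim: n w => // n IH w /ltnSE sw.
have [rw|/shorten[w' [sw' ew' subw']]] := boolP (reduced w); first by exists w; split.
have [w'' [rw'' ew'' subw'']] := IH w' (leq_trans sw' sw).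
by exists w''; split=> //; [rewrite ew'' | move=> x /subw'' /subw'].
Qed.

Lemma reduced_ex g : exists w, reduced w /\ ev w = g.
Proof.
have [w0 ->] := gen_words S g.
by have [w [rw ew _]] := reduced_sub w0; exists w; split.
Qed.

Lemma mem_walls_reduced r w : reduced w -> (r \in walls w) = crosses r (ev w).
Proof. by move=> rw; rewrite crosses_ev count_uniq_mem // oddb. Qed.

(** A wall of a reduced word is crossed once, hence an odd number of times by any word with the same
    value, which must therefore contain it. *)
Lemma size_reduced w1 w2 : reduced w1 -> ev w1 = ev w2 -> (size w1 <= size w2)%N.
Proof.
move=> r1 ew; rewrite -size_walls -(size_walls w2); apply: uniq_leq_size => // r.
rewrite mem_walls_reduced // ew crosses_ev => /odd_gt0.
by rewrite -has_count has_pred1.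
Qed.

Definition redw g : seq T := projT1 (cid (reduced_ex g)).
Lemma redw_reduced g : reduced (redw g). Proof. by rewrite /redw; case: cid => w []. Qed.
Lemma ev_redw g : ev (redw g) = g. Proof. by rewrite /redw; case: cid => w []. Qed.

Definition len g : nat := size (redw g).

Lemma len_ev w : (len (ev w) <= size w)%N.
Proof. by apply: size_reduced; rewrite ?redw_reduced ?ev_redw. Qed.

Lemma len1 : len 1 = 0%N.
Proof. by apply/eqP; rewrite -leqn0 -ev_nil len_ev. Qed.

Lemma lenM g h : (len (g * h) <= len g + len h)%N.
Proof. by rewrite -{1}(ev_redw g) -{1}(ev_redw h) -ev_cat -size_cat len_ev. Qed.

Lemma lenV g : len g^-1 = len g.
Proof.
have lenVle x : (len x^-1 <= len x)%N.
  by rewrite -{1}(ev_redw x) -ev_rev; apply: leq_trans (len_ev _) _; rewrite size_rev.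
by apply/eqP; rewrite eqn_leq lenVle -{1}(invgK g) lenVle.
Qed.

Definition dist x y : nat := len (x^-1 * y).

Lemma distC x y : dist x y = dist y x.
Proof. by rewrite /dist -lenV invgM invgK. Qed.

Lemma dist_tri y x z : (dist x z <= dist x y + dist y z)%N.
Proof.
rewrite /dist; have -> : x^-1 * z = (x^-1 * y) * (y^-1 * z) by gsimp.
exact: lenM.
Qed.

Lemma distxx x : dist x x = 0%N. Proof. by rewrite /dist mulVg len1. Qed.

(** The walls of a reduced word belong to a path from 1; conjugation by [x^-1] translates them to
    the path from [x]. *)
Definition wsep x y : seq G := [seq r ^ x^-1 | r <- walls (redw (x^-1 * y))].

Lemma mem_wsep r x y : (r \in wsep x y) = (crosses r x != crosses r y).
Proof.
rewrite /wsep -{1}[r](conjgK x) (mem_map (@conjg_inj _ x^-1)).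
rewrite mem_walls_reduced ?redw_reduced // ev_redw.
have := crosses_mul r x (x^-1 * y); rewrite mulVKg => ->.
by case: (crosses r x); case: crosses.
Qed.

Lemma wsep_uniq x y : uniq (wsep x y).
Proof. by rewrite (map_inj_uniq (@conjg_inj _ _)); exact: redw_reduced. Qed.

Lemma size_wsep x y : size (wsep x y) = dist x y.
Proof. by rewrite size_map size_walls. Qed.

Lemma size_le_dist (rs : seq G) x y : uniq rs ->
  (forall r, r \in rs -> crosses r x != crosses r y) -> (size rs <= dist x y)%N.
Proof.
by move=> ? sub; rewrite -size_wsep; apply: uniq_leq_size => // r /sub; rewrite mem_wsep.
Qed.

Lemma dist_le_size (rs : seq G) x y :
  (forall r, crosses r x != crosses r y -> r \in rs) -> (dist x y <= size rs)%N.
Proof.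
move=> sub; rewrite -size_wsep; apply: uniq_leq_size (wsep_uniq _ _) _ => r.
by rewrite mem_wsep => /sub.
Qed.

(* Every wall separating z from exactly one of u, v separates u from v. *)
Lemma dist_add_le (L : seq G) u v z :
  (forall r, crosses r u != crosses r z -> crosses r v != crosses r z -> r \in L) ->
  (dist u z + dist z v <= dist u v + 2 * size L)%N.
Proof.
move=> sub.
pose A := [seq r <- wsep u z | crosses r v == crosses r z].
pose B := [seq r <- wsep z v | crosses r u == crosses r z].
have sA : (dist u z <= size A + size L)%N.
  rewrite -size_cat; apply: dist_le_size => r ruz; rewrite mem_cat mem_filter mem_wsep ruz andbT.
  by have [//|rvz] := eqVneq (crosses r v) (crosses r z); rewrite sub.
have sB : (dist z v <= size B + size L)%N.
  rewrite -size_cat; apply: dist_le_size => r rzv; rewrite mem_cat mem_filter mem_wsep rzv andbT.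
  by have [//|ruz] := eqVneq (crosses r u) (crosses r z); rewrite sub // eq_sym.
have : (size (A ++ B) <= dist u v)%N.
  apply: size_le_dist => [|r]; last first.
    rewrite mem_cat !mem_filter !mem_wsep.
    by case/orP => /andP[/eqP->]; rewrite // eq_sym.
  rewrite cat_uniq !filter_uniq ?wsep_uniq // andbT /=.
  apply/hasPn => r; rewrite !mem_filter !mem_wsep => /andP[/eqP-> _].
  by rewrite eqxx andbF.
by rewrite size_cat; lia.
Qed.

Lemma len_reflect_lt r g : crosses r g -> (len (r * g) < len g)%N.
Proof.
rewrite -{1}(ev_redw g) -mem_walls_reduced ?redw_reduced // => /wallsP[w1 [s [w2 [gw ->]]]].
rewrite -{1}(ev_redw g) [in ltnLHS]gw wall_delete; apply: leq_ltn_trans (len_ev _) _.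
by rewrite /len gw !size_cat /= addnS.
Qed.

(** * Descents and the subgroups generated by two letters *)

Fixpoint alternating s t k : seq T :=
  if k is k'.+1 then s :: alternating t s k' else [::].

Lemma alternating_word s t w : {subset w <= [:: s; t]} ->
  exists k, ev w = ev (alternating s t k) \/ ev w = ev (alternating t s k).
Proof.
elim: w => [|u w IH] sub; first by exists 0%N; left.
have [|k wk] := IH; first by move=> x xw; apply: sub; rewrite inE xw orbT.
have push a b : ev w = ev (alternating a b k) \/ ev w = ev (alternating b a k) ->
    exists k', ev (a :: w) = ev (alternating a b k') \/ ev (a :: w) = ev (alternating b a k').
  case=> wE; last by exists k.+1; left; rewrite /= !ev_cons wE.
  case: k wE {wk} => [|k] wE; first by exists 1%N; left; rewrite /= !ev_cons wE.
  by exists k; right; rewrite ev_cons wE /= ev_cons genK.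
have := sub u; rewrite !inE eqxx /= => /(_ isT)/orP[]/eqP ->; first exact: push.
have [|k' wk'] := push t s; first by case: wk; [right|left].
by exists k'; case: wk'; [right|left].
Qed.

(** While [g] crosses a wall of the subgroup generated by [s] and [t], reflect it there; the length
    drops each time, so the process ends at some [g0]. *)
Lemma dihedral_coset s t g : exists w g0, [/\ {subset w <= [:: s; t]}, g = ev w * g0
  & forall w' u, {subset w' <= [:: s; t]} -> u \in [:: s; t] ->
      ~~ crosses (S u ^ (ev w')^-1) g0].
Proof.
have [n] := ubnP (len g); elim: n g => // n IH g /ltnSE gn.
have [[w' [u [w'st ust cr]]]|nex] := pselect (exists w' u, [/\ {subset w' <= [:: s; t]},
    u \in [:: s; t] & crosses (S u ^ (ev w')^-1) g]); last first.
  exists [::], g; split=> // [|w' u w'st ust]; first by rewrite ev_nil mul1g.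
  by apply/negP => cr; apply: nex; exists w', u.
have [w [g0 [wst gE g0P]]] := IH _ (leq_trans (len_reflect_lt cr) gn).
exists (w' ++ u :: rev w' ++ w), g0; split=> // [x|].
  rewrite mem_cat inE mem_cat mem_rev => /or4P[/w'st|/eqP->|/w'st|/wst] //.
by rewrite ev_cat ev_cons ev_cat ev_rev -!mulgA -gE; gsimp; rewrite genKr; gsimp.
Qed.

(** [s] and [t] act as the reflections of the line in -1/2 and 1/2, the other generators trivially.
    The one relation that could fail, between [s] and [t], is absent since they are not adjacent. *)
Lemma dihedral_lift s t : s != t -> ~~ e s t -> exists F : G -> int -> int,
  [/\ forall n, F 1 n = n, forall g h n, F (g * h) n = F g (F h n),
      forall n, F (S s) n = (- 1 - n)%R & forall n, F (S t) n = (1 - n)%R].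
Proof.
move=> st nest.
have [|u v n uv|F [F1 FM Fs]] := @gen_lift _ _ _ S int
  (fun u n => if u == s then - 1 - n else if u == t then 1 - n else n)%R.
- by move=> u n; case: (u == s) => /=; [lia|case: (u == t) => //; lia].
- move: uv; case: (u =P s) => [->|_]; case: (v =P s) => [->|_]; rewrite ?e_irr //.
  + by case: (v =P t) => [->|_]; rewrite ?(negPf nest).
  + by case: (u =P t) => [->|_]; rewrite // e_sym (negPf nest).
  + by case: (u =P t) => _; case: (v =P t).
exists F; split=> // n; rewrite Fs ?eqxx // eq_sym (negPf st) //.
Qed.

(* In the infinite dihedral group acting on the integers, the reflections
   crossed by s, st, sts, ... move the nonnegative integers to negative ones. *)
Lemma alternating_no_descent s t k : s != t -> ~~ e s t ->
  ~~ crosses (S t) (ev (alternating s t k)) /\ ~~ crosses (S s) (ev (alternating t s k)).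
Proof.
move=> st nest; have [F [F1 FM Fs Ft]] := dihedral_lift st nest.
have key : (forall r n, r \in walls (alternating s t k) -> 0 <= n -> F r n < 0)%R /\
    (forall r n, r \in walls (alternating t s k) -> n <= 0 -> 0 < F r n)%R.
  elim: k => // k [IHs IHt]; split=> r n /=; rewrite inE => /orP[/eqP->|/mapP[q qk ->]] n0.
  - by rewrite Fs; lia.
  - rewrite conjgE genV !FM !Fs; have := IHt q (- 1 - n)%R qk; set m := F q _; lia.
  - by rewrite Ft; lia.
  - rewrite conjgE genV !FM !Ft; have := IHs q (1 - n)%R qk; set m := F q _; lia.
have mem_cross r w : crosses r (ev w) -> r \in walls w.
  by rewrite crosses_ev => /odd_gt0; rewrite -has_count has_pred1.
split; apply/negP => /mem_cross.
  by move=> /(key.1 _ 0%R) /(_ (Order.le_refl _)); rewrite Ft.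
by move=> /(key.2 _ 0%R) /(_ (Order.le_refl _)); rewrite Fs.
Qed.

(** Splitting off [g0] moves both descents to an element of the subgroup of [s] and [t]. If the
    letters were not adjacent, that element would be an alternating word, which has at most one of
    the two descents. *)
Lemma descents_adjacent s t g :
  s != t -> crosses (S s) g -> crosses (S t) g -> e s t.
Proof.
move=> st sg tg; apply/negP => /negP nest; have nest' := nest.
have [w [g0 [wst gE g0P]]] := dihedral_coset s t g.
have red u : u \in [:: s; t] -> crosses (S u) g -> crosses (S u) (ev w).
  move=> ust; rewrite gE crosses_mul.
  have := g0P (rev w) u; rewrite ev_rev invgK => /(_ _ ust)/negPf ->; first by rewrite addbF.
  by move=> x; rewrite mem_rev => /wst.
have [k [wE|wE]] := alternating_word wst.
  have := red t; rewrite !inE eqxx orbT wE => /(_ isT tg).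
  by apply/negP; case: (alternating_no_descent k st nest').
have := red s; rewrite !inE eqxx wE => /(_ isT sg).
by apply/negP; case: (alternating_no_descent k st nest').
Qed.

Lemma gen_commJ s t : e s t -> S s ^ S t = S s.
Proof. by move=> est; rewrite conjgE (gen_comm S est) mulKg. Qed.

(** Both [s] and the first letter of [w] are descents of [S s * ev w = ev w * S s], hence adjacent;
    deleting that letter preserves the hypotheses. *)
Lemma adjacent_of_commute s w : reduced w ->
  S s * ev w = ev w * S s -> ~~ crosses (S s) (ev w) -> {in w, forall t, e s t}.
Proof.
elim: w => // b w IH rbw comm ns.
have est : e s b.
  apply: (@descents_adjacent _ _ (S s * ev (b :: w))).
  - apply: contraNneq ns => ->.
    by rewrite -mem_walls_reduced //= inE eqxx.
  - by rewrite crosses_mul crosses_gen eqxx conjgE mulKg (negPf ns).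
  rewrite comm crosses_mul -mem_walls_reduced //= inE eqxx /= crosses_gen.
  apply: contra ns => /eqP bs; have {}bs : S b = S s.
    by apply: (conjg_inj (ev (b :: w))); rewrite bs conjgE comm mulKg.
  by rewrite -bs -mem_walls_reduced //= inE eqxx.
have sb := gen_comm S est.
move=> t; rewrite inE => /orP[/eqP->//|]; apply: IH.
- by move: rbw; rewrite /reduced /= (map_inj_uniq (@conjg_inj _ _)) => /andP[].
- by apply: (mulgI (S b)); rewrite !mulgA -sb; move: comm; rewrite ev_cons !mulgA.
have := ns; rewrite ev_cons crosses_mul crosses_gen.
case: (S s =P S b) => [/gen_inj sb'|_]; first by move: est; rewrite sb' e_irr.
by rewrite gen_commJ.
Qed.

(** Take the edge at which a reduced path from [x] to [y] crosses [r], and its end on the side of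
    [x]. Up to there the path has crossed only walls separating [x] from [y]. *)
Lemma edge_between r x y : crosses r x != crosses r y ->
  exists z s, [/\ r = S s ^ z^-1, crosses r z = crosses r x
    & forall r', crosses r' x = crosses r' y -> crosses r' z = crosses r' x].
Proof.
rewrite -mem_wsep => /mapP[q /wallsP[w1 [s [w2 [ww ->]]]] rE].
have := redw_reduced (x^-1 * y); have := ev_redw (x^-1 * y); rewrite ww => ew rw.
have rw1 : reduced w1 by move: rw; rewrite /reduced walls_cat cat_uniq => /andP[].
exists (x * ev w1), s; split; first by rewrite rE invgM conjgM.
  rewrite crosses_mul rE conjgKV -mem_walls_reduced //.
  case: (boolP (_ \in _)); rewrite ?addbF // => sw1.
  move: rw; rewrite /reduced walls_cat cat_uniq => /and3P[_ /hasPn nw _].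
  by have := nw (S s ^ (ev w1)^-1); rewrite /= inE eqxx sw1 => /(_ isT).
move=> r' r'xy; rewrite crosses_mul -mem_walls_reduced //.
case: (boolP (_ \in _)); rewrite ?addbF // => sw1.
have := r'xy; rewrite -[y](mulVKg x) crosses_mul -ew -mem_walls_reduced //.
by rewrite walls_cat mem_cat sw1 /=; case: crosses.
Qed.

(** * Crossing walls, meets and medians *)

Definition crossing r r' : Prop :=
  forall b b', exists x, crosses r x = b /\ crosses r' x = b'.

Lemma crossing_sym r r' : crossing r r' -> crossing r' r.
Proof. by move=> cr b b'; have [x []] := cr b' b; exists x. Qed.

(** Take an edge dual to [r] on each side of [r']. Both have the same letter [s], and the element
    leading from one to the other commutes with [S s], so every letter of its reduced word is
    adjacent to [s], including the one that crosses [r']. *)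
Lemma crossing_type r r' : crossing r r' ->
  exists s t, [/\ e s t, exists z, r = S s ^ z & exists z, r' = S t ^ z].
Proof.
move=> cr; have edge b : exists z s, [/\ r = S s ^ z^-1, crosses r z = false
    & crosses r' z = b].
  have [x [rx r'x]] := cr false b; have [y [ry r'y]] := cr true b.
  have [|z [s [rE rz r'z]]] := @edge_between r x y; first by rewrite rx ry.
  by exists z, s; split; rewrite ?rz // r'z ?r'x.
have [x [s [rx r0 r'0]]] := edge false; have [y [s' [ry r1 r'1]]] := edge true.
have ss : s' = s by apply/eqP; rewrite -(parity_refl s s' y^-1) -ry rx parity_refl.
subst s'; have : r' \in wsep x y by rewrite mem_wsep r'0 r'1.
case/mapP => q /wallsP[w1 [t [w2 [ww ->]]]] r'E.
exists s, t; split; last by exists ((ev w1)^-1 * x^-1); rewrite conjgM.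
  apply: (@adjacent_of_commute s (redw (x^-1 * y))); rewrite ?redw_reduced // ?ev_redw.
  - have : S s ^ (x^-1 * y) = S s by rewrite conjgM -rx ry conjgKV.
    by move=> {2}<-; rewrite conjgE mulVKg.
  - have := crosses_mul r x (x^-1 * y); rewrite mulVKg r0 r1 /= [in r ^ x]rx conjgKV.
    by move=> <-.
  - by rewrite ww mem_cat inE eqxx orbT.
by exists x^-1.
Qed.

Lemma crossing_adjacent r r' s t :
  crossing r r' -> parity s r -> parity t r' -> e s t.
Proof.
case/crossing_type => s' [t' [est [z ->] [z' ->]]].
by rewrite !parity_refl => /eqP <- /eqP <-.
Qed.

Lemma parity_of_wall r x : crosses r x -> exists s, parity s r.
Proof.
move=> rx; have [|z [s [-> _ _]]] := @edge_between r x 1; first by rewrite rx crosses1.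
by exists s; rewrite parity_refl.
Qed.

Lemma crosses_split r w : crosses r (ev w) -> exists w1 s w2,
  [/\ w = w1 ++ s :: w2, r = S s ^ (ev w1)^-1 & r \notin walls w1].
Proof.
elim: w r => [|s w IH] r; first by rewrite ev_nil crosses1.
rewrite ev_cons crosses_mul crosses_gen.
have [-> _|rs /IH[w1 [t [w2 [-> rE rw1]]]]] := eqVneq r (S s).
  by exists [::], s, w; rewrite ev_nil invg1 conjg1.
exists (s :: w1), t, w2; split=> //.
  by rewrite ev_cons invgM conjgM -rE conjgK.
rewrite /= inE (negPf rs) /=; apply: contra rw1 => /mapP[q qw ->].
by rewrite -conjgM gen_sqr conjg1.
Qed.

Lemma ev_comm t w : {in w, forall c, e c t} -> S t * ev w = ev w * S t.
Proof.
elim: w => [|c w IH] cw; first by rewrite ev_nil mulg1 mul1g.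
rewrite ev_cons mulgA -(gen_comm S (cw c _)) ?inE ?eqxx // -!mulgA IH // => x xw.
by apply: cw; rewrite inE xw orbT.
Qed.

(* The first wall common to y and z along a reduced word of z crosses all the
   earlier walls, so its reflection is the letter itself. *)
Lemma common_descent r y z : crosses r y -> crosses r z ->
  exists s, crosses (S s) y && crosses (S s) z.
Proof.
move=> ry rz; have [w [rw wE]] := reduced_ex z; rewrite -wE in rz *.
have [n] := ubnP (index r (walls w)); elim: n r ry rz => // n IH r ry rz /ltnSE rn.
have [w1 [t [w2 [ww rE rw1]]]] := crosses_split rz.
have [/hasP[q qw1 qy]|/hasPn no] := boolP (has (fun q => crosses q y) (walls w1)).
  have qw : q \in walls w by rewrite ww walls_cat mem_cat qw1.
  apply: (IH q) => //; first by rewrite -mem_walls_reduced.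
  apply: leq_trans rn; rewrite ww walls_cat !index_cat qw1 (negPf rw1).
  by rewrite ltn_addr // index_mem.
have red1 : reduced w1 by move: rw; rewrite ww /reduced walls_cat cat_uniq => /andP[].
have tw1 : {in w1, forall c, e c t}.
  move=> c cw1; have [v1 [v2 wv]] : exists v1 v2, w1 = v1 ++ c :: v2.
    by case/splitPr: cw1 => v1 v2; exists v1, v2.
  pose u := S c ^ (ev v1)^-1.
  have uw1 : u \in walls w1 by rewrite wv walls_cat mem_cat /= inE eqxx orbT.
  apply: (@crossing_adjacent u r); rewrite ?rE ?parity_refl //.
  case=> -[].
  - by exists (ev w); rewrite -{1}mem_walls_reduced // ww walls_cat mem_cat uw1 -ww -rE rz.
  - by exists (ev w1); rewrite -rE -!mem_walls_reduced // uw1 (negPf rw1).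
  - by exists y; rewrite -rE ry; split=> //; exact: negbTE (no _ uw1).
  - by exists 1; rewrite !crosses1.
exists t; have <- : r = S t; last by rewrite ry.
by rewrite rE conjgE invgK mulgA -(ev_comm tw1) mulgK.
Qed.

(** Meets in the weak order: a common descent is split off from both elements, and the meet of the
    remainders is multiplied by it. *)
Lemma meet_ex y z : exists m, forall r, crosses r m = crosses r y && crosses r z.
Proof.
have [n] := ubnP (len y); elim: n y z => // n IH y z /ltnSE yn.
have [[r /andP[ry rz]]|no] := pselect (exists r, crosses r y && crosses r z); last first.
  by exists 1 => r; rewrite crosses1; apply/esym/negbTE/negP => ryz; apply: no; exists r.
have [s /andP[sy sz]] := common_descent ry rz.
have [|m mP] := IH (S s * y) (S s * z); first exact: leq_trans (len_reflect_lt sy) yn.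
exists (S s * m) => q; rewrite crosses_mul mP !crosses_mul !crosses_gen -conjgM gen_sqr conjg1.
have -> : (q ^ S s == S s) = (q == S s).
  by rewrite (can2_eq (conjgK _) (conjgKV _)) conjgE invgK mulgV mulg1.
by have [->|_] := eqVneq q (S s); rewrite ?sy ?sz.
Qed.

Definition majority (a b c : bool) := if a == b then a else c.

(** The median is the meet of [y] and [z] in the weak order based at [x]. *)
Lemma median_ex x y z : exists m, forall r,
  crosses r m = majority (crosses r x) (crosses r y) (crosses r z).
Proof.
have [m mP] := meet_ex (x^-1 * y) (x^-1 * z).
exists (x * m) => r; rewrite crosses_mul mP /majority.
have sep v : crosses (r ^ x) (x^-1 * v) = crosses r x (+) crosses r v.
  by have := crosses_mul r x (x^-1 * v); rewrite mulVKg => ->; rewrite addKb.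
by rewrite !sep; case: (crosses r x); case: (crosses r y); case: (crosses r z).
Qed.

End Walls.

Lemma seq_bound (X : eqType) (L : seq X) (P : X -> nat -> Prop) :
  (forall x, x \in L -> exists N, forall M, (N <= M)%N -> P x M) ->
  exists N, forall x, x \in L -> P x N.
Proof.
move=> PL; suff [N NP] : exists N, forall x, x \in L -> forall M, (N <= M)%N -> P x M.
  by exists N => x xL; exact: NP.
elim: L PL => [|a L IH] PL; first by exists 0%N.
have [|N NP] := IH; first by move=> x xL; apply: PL; rewrite inE xL orbT.
have [|N' NP'] := PL a; first by rewrite inE eqxx.
exists (maxn N N') => x; rewrite inE => /orP[/eqP->|xL] M; rewrite geq_max => /andP[NM N'M].
  exact: NP'.
exact: NP.
Qed.

Lemma change_step (X : eqType) (f : nat -> X) i j : (i <= j)%N -> f i != f j ->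
  exists k, [/\ (i <= k)%N, (k < j)%N & f k != f k.+1].
Proof.
elim: j => [|j IH]; first by rewrite leqn0 => /eqP->; rewrite eqxx.
rewrite leq_eqVlt => /orP[/eqP->|/ltnSE ij]; first by rewrite eqxx.
have [fij|fij fiSj] := eqVneq (f i) (f j).
  by rewrite fij => fSj; exists j; split.
by have [k [? ? ?]] := IH ij fij; exists k; split=> //; exact: ltnW.
Qed.

Lemma pigeonhole (X Y : eqType) (f : X -> Y) (xs : seq X) (ys : seq Y) :
  uniq xs -> {in xs, forall x, f x \in ys} -> (size ys < size xs)%N ->
  exists x x', [/\ x \in xs, x' \in xs, x != x' & f x = f x'].
Proof.
move=> uxs fys sxs; have [inj|ninj] := pselect {in xs &, injective f}.
  have : uniq (map f xs) by rewrite map_inj_in_uniq.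
  move/uniq_leq_size => /(_ ys); rewrite size_map leqNgt sxs => /(_ _)/notF [].
  by move=> _ /mapP[x /fys ? ->].
apply: contrapT => nex; apply: ninj => x x' xx xx' fxx'; apply: contrapT => /eqP xx''.
by apply: nex; exists x, x'.
Qed.

(** * Subgroups acting freely on the walls *)

Section Subgroup.
Variables (T : finType) (e : rel T).
Hypotheses (e_sym : symmetric e) (e_irr : irreflexive e).
Variables (G : groupType) (S : coxeter_presentation e G) (H : groupClosed G).
Hypothesis H_cent : forall h g, h \in H -> h != 1 -> g * h = h * g -> g \in H.
Hypothesis H_refl : forall s g, S s ^ g \notin H.
Implicit Types (s t : T) (w : seq T) (r g h x y z : G).

Local Notation cr := (crosses S).
Local Notation d := (dist S).
Local Notation ev := (ev S).

(** This is the freeness of [H] on the walls: an [h] fixing a wall commutes with its reflection, and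
    the centralizer of a nontrivial [h] lies in [H]. *)
Lemma refl_stab s g h : h \in H -> S s ^ g * h = h * S s ^ g -> h = 1.
Proof.
move=> hH comm; apply/eqP; apply: contraT => h1.
by have := H_cent hH h1 comm; rewrite (negPf (H_refl s g)).
Qed.

Lemma ev_comm2 a b : (forall s t, s \in a -> t \in b -> e s t) ->
  ev a * ev b = ev b * ev a.
Proof.
elim: a => [|s a IH] ab; first by rewrite ev_nil mulg1 mul1g.
rewrite ev_cons -mulgA IH; last by move=> u t ua; apply: ab; rewrite inE ua orbT.
rewrite !mulgA (ev_comm S) // => t tb.
by rewrite e_sym ab // inE eqxx.
Qed.

(** [ev a] and [ev b] commute with their product, so for nontrivial [h] their conjugates lie in [H].
    Each of them commutes with a generator, [u] or [v], hence fixes a wall and is trivial. *)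
Lemma join_trivial h x a b u v : h \in H -> h ^ x = ev a * ev b ->
  (forall s t, s \in a -> t \in b -> e s t) ->
  {in a, forall s, e s u} -> {in b, forall t, e t v} -> h = 1.
Proof.
move=> hH hE ab au bv; apply/eqP; apply: contraT => h1.
have abC := ev_comm2 ab.
have {}hE : h = (ev a * ev b) ^ x^-1 by rewrite -hE conjgK.
have reflC w s : {in w, forall c, e c s} -> ev w ^ x^-1 \in H -> ev w = 1.
  move=> ws wH; apply: (conjg_inj x^-1); rewrite conj1g.
  by apply: (@refl_stab s x^-1) => //; rewrite -!conjMg (ev_comm S ws).
have inH w : ev w * (ev a * ev b) = ev a * ev b * ev w -> ev w ^ x^-1 \in H.
  by move=> wab; apply: (H_cent hH h1); rewrite hE -!conjMg wab.
have a1 : ev a = 1 by apply: (reflC a u) => //; apply: inH; rewrite -mulgA abC.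
have b1 : ev b = 1 by apply: (reflC b v) => //; apply: inH; rewrite mulgA -abC.
by move: h1; rewrite hE a1 b1 mulg1 conj1g eqxx.
Qed.

Lemma ev_sort w (A : pred T) :
  (forall s t, t \in w -> A s -> ~~ A t -> e s t) ->
  ev w = ev [seq s <- w | A s] * ev [seq s <- w | ~~ A s].
Proof.
elim: w => [|c w IH] wA; first by rewrite /= ev_nil mulg1.
have {}IH : ev w = ev [seq s <- w | A s] * ev [seq s <- w | ~~ A s].
  by apply: IH => s t tw; apply: wA; rewrite inE tw orbT.
rewrite /= ev_cons IH; case: ifP => Ac /=; first by rewrite ev_cons mulgA.
rewrite ev_cons !mulgA (ev_comm S) // => s; rewrite mem_filter => /andP[As _].
by apply: wA; rewrite ?inE ?eqxx ?Ac.
Qed.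

Fixpoint word_ball R : seq G :=
  if R is R'.+1 then 1 :: [seq S s * g | s <- enum T, g <- word_ball R'] else [:: 1].

Lemma mem_word_ball R g : (len S g <= R)%N -> g \in word_ball R.
Proof.
rewrite -{2}(ev_redw S g) /len; elim: (redw S g) R => [|s w IH] R.
  by rewrite ev_nil => _; case: R => [|R] /=; rewrite inE eqxx.
case: R => // R; rewrite ltnS => wR; rewrite /= inE; apply/orP; right.
by apply/allpairsP; exists (s, ev w); rewrite mem_enum IH // ev_cons.
Qed.

Definition track (p : nat -> G) i j : seq G :=
  flatten [seq wsep S (p k) (p k.+1) | k <- iota i (j - i)].

Lemma mem_track r p i j k : (i <= k)%N -> (k < j)%N ->
  cr r (p k) != cr r (p k.+1) -> r \in track p i j.
Proof.
move=> ik kj rk; apply/flatten_mapP; exists k; last by rewrite mem_wsep.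
by rewrite mem_iota ik subnKC // ltnW // (leq_ltn_trans ik).
Qed.

Variables (bs : seq G) (lB : G -> nat).

(* In the application, lB is the word length of H for a finite generating set and
   bs lists the generators with their inverses. *)
Definition geo (p : nat -> G) n := [/\ forall i, (i <= n)%N -> p i \in H,
  forall i, (i < n)%N -> (p i)^-1 * p i.+1 \in bs
  & forall i j, (i <= j)%N -> (j <= n)%N -> (j - i <= lB ((p i)^-1 * p j))%N].

(** The successor makes [beta] positive, so that distinct multiples of it can be told apart. *)
Definition beta := (\max_(b <- bs) len S b).+1.

Lemma len_bs b : b \in bs -> (len S b <= beta)%N.
Proof. by move=> bbs; apply: leqW; apply: leq_bigmax_seq. Qed.

Lemma geo_step p n i : geo p n -> (i < n)%N -> (d (p i) (p i.+1) <= beta)%N.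
Proof. by case=> _ steps _ /steps; exact: len_bs. Qed.

Lemma geo_dist p n i j : geo p n -> (i <= j)%N -> (j <= n)%N ->
  (d (p i) (p j) <= (j - i) * beta)%N.
Proof.
move=> gp; elim: j => [|j IH]; first by rewrite leqn0 => /eqP-> _; rewrite distxx.
rewrite leq_eqVlt => /orP[/eqP->|/ltnSE ij] jn; first by rewrite distxx.
have := dist_tri S (p j) (p i) (p j.+1); have := geo_step gp jn.
by have := IH ij (ltnW jn); rewrite subSn // mulSn; lia.
Qed.

Lemma size_track p n i j : geo p n -> (j <= n)%N -> (size (track p i j) <= (j - i) * beta)%N.
Proof.
move=> gp jn; rewrite /track.
have : forall k, k \in iota i (j - i) -> (k < n)%N by move=> k; rewrite mem_iota; lia.
rewrite -{3}(size_iota i (j - i)); elim: (iota _ _) => //= k ks IH kn.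
rewrite size_cat size_wsep mulSn leq_add //.
  by apply: geo_step gp _; apply: kn; rewrite inE eqxx.
by apply: IH => l lks; apply: kn; rewrite inE lks orbT.
Qed.

(* H acts freely on the walls, so the position of a wall relative to the step
   of p crossing it determines that step. *)
Lemma recross_bound : exists D, forall p n r i j, geo p n -> (i <= j)%N -> (j < n)%N ->
  cr r (p i) != cr r (p i.+1) -> cr r (p j) != cr r (p j.+1) -> (j - i <= D)%N.
Proof.
pose F := flatten [seq walls S (redw S b) | b <- bs].
have [|D DP] := @seq_bound _ [seq (f, f') | f <- F, f' <- F]
  (fun ff N => forall h, h \in H -> ff.1 ^ h = ff.2 -> (lB h <= N)%N).
  move=> [f f'] /allpairsP[[q q'] /= [qF _ [-> ->]]] {f f'}.
  have [b _ /wallsP[w1 [s [w2 [_ qE]]]]] := flatten_mapP qF.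
  have [[h0 [h0H qh0]]|no] := pselect (exists h0, h0 \in H /\ q ^ h0 = q'); last first.
    by exists 0%N => M _ h hH qh; case: no; exists h.
  exists (lB h0) => M h0M h hH qh; rewrite (_ : h = h0) //.
  apply/eqP; rewrite -divg_eq1; apply/eqP.
  apply: (@refl_stab s (ev w1)^-1); first by rewrite gpredF.
  rewrite -qE; have : q ^ (h / h0) = q by rewrite conjgM qh -qh0 conjgK.
  by rewrite conjgE => {2}<-; rewrite mulVKg.
exists D => p n r i j gp ij jn ri rj; have [pH steps lBp] := gp.
have inn : (i < n)%N := leq_ltn_trans ij jn.
have inF k : (k < n)%N -> cr r (p k) != cr r (p k.+1) -> r ^ p k \in F.
  move=> kn; rewrite -mem_wsep => /mapP[q qw ->]; rewrite conjgKV.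
  by apply/flatten_mapP; exists ((p k)^-1 * p k.+1); first exact: steps.
apply: leq_trans (lBp _ _ ij (ltnW jn)) _.
apply: (DP (r ^ p i, r ^ p j)); first by apply/allpairsP; exists (r ^ p i, r ^ p j); rewrite !inF.
  by rewrite gpredM ?gpredV ?pH // ltnW.
by rewrite /= -conjgM mulVKg.
Qed.

(** * Halfspaces and pivots *)

Definition beyond o V x : bool := cr V x != cr V o.

Lemma crossing_beyond o V W : crossing S V W <->
  forall b b', exists x, beyond o V x = b /\ beyond o W x = b'.
Proof.
split=> cVW b b'.
  have [x [Vx Wx]] := cVW (cr V o (+) b) (cr W o (+) b'); exists x.
  by rewrite /beyond {}Vx {}Wx; case: (cr V o); case: (cr W o); case: b; case: b'.
have [x []] := cVW (cr V o (+) b) (cr W o (+) b'); rewrite /beyond => Vx Wx; exists x.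
by move: Vx Wx; case: (cr V o); case: (cr W o); case: (cr V x); case: (cr W x); case: b; case: b'.
Qed.

Lemma crossing4 o V W (x0 x1 x2 x3 : G) :
  ~~ beyond o V x0 -> ~~ beyond o W x0 -> ~~ beyond o V x1 -> beyond o W x1 ->
  beyond o V x2 -> ~~ beyond o W x2 -> beyond o V x3 -> beyond o W x3 -> crossing S V W.
Proof.
move=> /negPf V0 /negPf W0 /negPf V1 W1 V2 /negPf W2 V3 W3.
by apply/(crossing_beyond o) => -[] [];
  [exists x3|exists x2|exists x1|exists x0]; rewrite ?V0 ?V1 ?W0 ?W2.
Qed.

(* V is crossed by p an odd number of times, always between times a and b. *)
Definition pivot V (p : nat -> G) n a b :=
  (forall k, (k <= a)%N -> ~~ beyond (p 0%N) V (p k)) /\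
  (forall k, (b <= k)%N -> (k <= n)%N -> beyond (p 0%N) V (p k)).

(** If all walls separating the ends of the window were crossed within time [D] of these ends, the
    ends would be at distance at most [2 * D * beta], and a ball contains only elements of bounded
    [lB]. A wall that avoids both margins cannot be crossed outside the window, by
    [recross_bound]. *)
Lemma pivot_ex : exists2 M, (0 < M)%N & forall p n i, geo p n -> (i + M <= n)%N ->
  exists V, pivot V p n i (i + M).
Proof.
have [D DP] := recross_bound.
have [|M MP] := @seq_bound _ (word_ball (2 * D * beta)) (fun g N => (lB g <= N)%N).
  by move=> g _; exists (lB g).
exists M.+1 => // p n i gp iMn; have [pH steps lBp] := gp.
have ii : (i <= i + M.+1)%N by exact: leq_addr.
pose L := track p i (minn (i + D) (i + M.+1)) ++ track p (i + M.+1 - D) (i + M.+1).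
have sL : (size L <= 2 * D * beta)%N.
  rewrite size_cat -mulnA mul2n -addnn; apply: leq_add.
    apply: leq_trans (size_track _ gp _) _; first by lia.
    by rewrite leq_mul2r; lia.
  by apply: leq_trans (size_track _ gp _) _; rewrite // leq_mul2r; lia.
have [V Vw VL] : exists2 V, V \in wsep S (p i) (p (i + M.+1)%N) & V \notin L.
  have [/hasP[V]|/hasPn no] := boolP (has [predC L] (wsep S (p i) (p (i + M.+1)%N))).
    by exists V.
  have : (d (p i) (p (i + M.+1)%N) <= 2 * D * beta)%N.
    rewrite -size_wsep; apply: leq_trans sL; apply: uniq_leq_size => [|V /no].
      exact: wsep_uniq.
    by rewrite negbK.
  by move/mem_word_ball/MP; have := lBp _ _ ii iMn; lia.
move: VL Vw; rewrite mem_cat mem_wsep => /norP[VL1 VL2] Vi.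
have [k [ik kiM rk]] := @change_step _ (fun k => cr V (p k)) _ _ ii Vi.
have before l : (l <= i)%N -> cr V (p 0%N) = cr V (p l).
  move=> li; apply/eqP; apply: contraT => V0l.
  have [j [_ jl rj]] := @change_step _ (fun k => cr V (p k)) _ _ (leq0n _) V0l.
  have := DP p n V j k gp _ _ rj rk => kj.
  by move: VL1; rewrite (@mem_track _ _ _ _ k) //; lia.
have after l : (i + M.+1 <= l)%N -> (l <= n)%N -> cr V (p (i + M.+1)%N) = cr V (p l).
  move=> il ln; apply/eqP; apply: contraT => V0l.
  have [j [ij jl rj]] := @change_step _ (fun k => cr V (p k)) _ _ il V0l.
  have := DP p n V k j gp _ _ rk rj => kj.
  by move: VL2; rewrite (@mem_track _ _ _ _ k) //; lia.
exists V; split=> l; rewrite /beyond.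
  by move=> li; rewrite -(before l) // negbK.
by move=> il ln; rewrite -(after l) // (before i) // eq_sym.
Qed.

(** The points [p 0], [p a'] and [p n] realize three of the four quadrants; a point beyond [W] but
    not beyond [V] would realize the fourth. *)
Lemma pivot_nested V W p n a b a' b' : (b <= a')%N -> (a' <= b')%N -> (b' <= n)%N ->
  pivot V p n a b -> pivot W p n a' b' -> ~ crossing S V W ->
  forall x, beyond (p 0%N) W x -> beyond (p 0%N) V x.
Proof.
move=> ba' a'b' b'n [Va Vb] [Wa Wb] nVW x Wx; apply: contraT => Vx; case: nVW.
apply: (@crossing4 (p 0%N) V W (p 0%N) x (p a') (p n)) => //.
- exact: Va.
- exact: Wa.
- by apply: Vb => //; lia.
- exact: Wa.
- by apply: Vb => //; lia.
- by apply: Wb.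
Qed.

Lemma crossing_between o U V W Y : crossing S U V -> crossing S U Y ->
  (forall x, beyond o W x -> beyond o V x) -> (forall x, beyond o Y x -> beyond o W x) ->
  crossing S U W.
Proof.
move=> /(crossing_beyond o) UV /(crossing_beyond o) UY WV YW.
apply/(crossing_beyond o) => b -[].
  by have [x [Ux /YW Wx]] := UY b true; exists x.
have [x [Ux Vx]] := UV b false; exists x; split=> //.
by apply/negbTE/negP => /WV; rewrite Vx.
Qed.

(** * Walls crossing many walls of a geodesic *)

Hypothesis lB1 : lB 1 = 0%N.

Definition transverse U (p : nat -> G) n : seq G :=
  [seq W <- wsep S (p 0) (p n) | `[< crossing S U W >]].

Lemma mem_transverse U p n W : (W \in transverse U p n) <->
  crossing S U W /\ cr W (p 0%N) != cr W (p n).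
Proof. by rewrite mem_filter mem_wsep; split=> [/andP[/asboolP]|[/asboolP-> ->]]. Qed.

Lemma majority_sep a b c : a != b -> majority a b c = c.
Proof. by case: a; case: b; case: c. Qed.

Lemma neq_trans_bool (a b c : bool) : a != b -> c != a -> c = b.
Proof. by case: a; case: b; case: c. Qed.

(** Otherwise two times [i < j] have equal [color] but different counts [c]. The letters leading
    from [z i] to [z j] split into [A], adjacent to the type of [U], and letters adjacent to all of
    [A]. As [p j * (p i)^-1] also carries [z i] to [z j], it is 1 by [join_trivial]. *)
Lemma projection_bound : exists n0, forall U p n, geo p n ->
  (size (transverse U p n) <= n0)%N.
Proof.
have [D DP] := recross_bound.
pose cols := [seq (ab, cf) | ab <- [seq (a, b) | a <- iota 0 D.+1, b <- enum {set T}],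
                             cf <- [seq (c, f) | c <- enum {set T}, f <- word_ball (D * beta)]].
exists (size cols * beta)%N => U p n gp; rewrite leqNgt; apply/negP => big.
have [pH steps lBp] := gp; pose rs := transverse U p n.
have cross_steps r i j i' j' : cr r (p i) != cr r (p j) -> cr r (p i') != cr r (p j') ->
    (i <= j)%N -> (j <= i')%N -> (i' <= j')%N -> (j' <= n)%N ->
    exists2 k, (i <= k < j)%N && (i' < k + D.+1)%N & cr r (p k) != cr r (p k.+1).
  move=> rij rij' ij ji' ij' jn.
  have [k [ik kj rk]] := @change_step _ (fun k => cr r (p k)) _ _ ij rij.
  have [k' [ik' kj' rk']] := @change_step _ (fun k => cr r (p k)) _ _ ij' rij'.
  exists k => //; have := DP p n r k k' gp _ _ rk rk'; lia.
(* [z i] projects [p i] to the interval between the ends of [p]: only walls crossed both before and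
   after time [i] separate the two. *)
pose z i := projT1 (cid (median_ex e_sym e_irr S (p 0%N) (p n) (p i))).
have zP i r : cr r (z i) = majority (cr r (p 0%N)) (cr r (p n)) (cr r (p i)).
  by rewrite /z; case: cid.
have zp i : (i <= n)%N -> (d (p i) (z i) <= D * beta)%N.
  move=> i_n; apply: (@leq_trans (size (track p (i - D) i))); last first.
    by apply: leq_trans (size_track _ gp i_n) _; rewrite leq_mul2r; lia.
  apply: dist_le_size => r; rewrite zP /majority.
  have [p0n pi0|_] := eqVneq (cr r (p 0%N)) (cr r (p n)); last by rewrite eqxx.
  have p0i : cr r (p 0%N) != cr r (p i) by rewrite eq_sym.
  have pin : cr r (p i) != cr r (p n) by rewrite -p0n.
  have [k kP rk] := cross_steps _ _ _ _ _ p0i pin (leq0n _) (leqnn _) i_n (leqnn _).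
  by apply: (@mem_track _ _ _ _ k) rk; lia.
pose th1 i := [set s | has (fun W => parity S s W && (cr W (p 0%N) != cr W (p i))) rs].
pose th2 i := [set s | has (fun W => parity S s W && (cr W (p i) != cr W (p n))) rs].
pose color i := (((i %% D.+1)%N, th1 i), (th2 i, (p i)^-1 * z i)).
pose c i := count (fun W => cr W (p 0%N) != cr W (p i)) rs.
have rs_sep W : W \in rs -> cr W (p 0%N) != cr W (p n) by move/mem_transverse=> [].
have rs_cross W : W \in rs -> crossing S U W by move/mem_transverse=> [].
have rs_uniq : uniq rs by rewrite filter_uniq ?wsep_uniq.
have key i j : (i < j)%N -> (j <= n)%N -> color i = color j -> c i <> c j -> False.
  move=> ij jn [modij th1ij th2ij zij] cij.
  (* The residue modulo [D.+1] is part of the colour for this: with more than [D] between [i] and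
     [j], no wall is crossed both before [i] and after [j]. *)
  have Dij : (D < j - i)%N.
    move: modij => /eqP; rewrite eq_sym eqn_mod_dvd; last exact: ltnW.
    by apply: dvdn_leq; rewrite subn_gt0.
  have mono V : cr V (z i) != cr V (z j) ->
      [/\ cr V (p i) = cr V (p 0%N), cr V (p j) = cr V (p n),
          cr V (p 0%N) != cr V (p n) & cr V (p i) != cr V (p j)].
    rewrite !zP; have [p0n|p0n] := eqVneq (cr V (p 0%N)) (cr V (p n)).
      by rewrite /majority p0n !eqxx.
    rewrite !majority_sep // => pij.
    suff pi0 : cr V (p i) = cr V (p 0%N).
      by split=> //; apply: neq_trans_bool p0n _; rewrite -pi0 eq_sym.
    apply/eqP; apply: contraT; rewrite eq_sym => p0i.
    have pjn : cr V (p j) != cr V (p n).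
      move: p0n p0i pij; case: (cr V (p 0%N)); case: (cr V (p i));
      by case: (cr V (p j)); case: (cr V (p n)).
    have [k] := cross_steps _ _ _ _ _ p0i pjn (leq0n _) (ltnW ij) jn (leqnn _); lia.
  have rs_mono W : W \in rs -> cr W (p i) != cr W (p j) -> cr W (z i) != cr W (z j).
    by move=> Wrs; rewrite !zP !majority_sep // rs_sep.
  pose A := [pred s | has (fun W => parity S s W && (cr W (p i) != cr W (p j))) rs].
  have [s0 As0] : exists s0, A s0.
    have [/hasP[W Wrs Wij]|/hasPn no] := boolP (has (fun W => cr W (p i) != cr W (p j)) rs).
      have [x [Wx _]] := crossing_sym (rs_cross _ Wrs) true true.
      by have [s sW] := parity_of_wall Wx; exists s; apply/hasP; exists W; rewrite ?sW.
    by case: cij; apply: eq_in_count => W /no; rewrite negbK => /eqP->.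
  have [x [Ux _]] : exists x, cr U x = true /\ true.
    case/hasP: As0 => W /rs_cross UW _.
    by have [x [Ux _]] := UW true true; exists x.
  have [u uU] := parity_of_wall Ux.
  have Au s : A s -> e s u.
    case/hasP => W Wrs /andP[sW _].
    exact: (crossing_adjacent e_sym e_irr (crossing_sym (rs_cross _ Wrs)) sW uU).
  pose w := redw S ((z i)^-1 * z j).
  (* The wall [V] of a letter [t] outside [A] does not cross [U], so some side of [U] misses the
     side [b'] of [V]. A wall that crosses [U] and separates two points of the side [b'] then
     crosses [V]. Equality of colours supplies one of type [s]: crossed before [i] if [p 0] is on
     the side [b'], after [j] otherwise. *)
  have wA s t : t \in w -> A s -> ~~ A t -> e s t.
    move=> tw As nAt; have [w1 [w2 ww]] : exists w1 w2, w = w1 ++ t :: w2.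
      by case/splitPr: tw => w1 w2; exists w1, w2.
    pose V := (S t ^ (ev w1)^-1) ^ (z i)^-1.
    have tV : parity S t V by rewrite !parityJ parity_gen.
    have Vz : cr V (z i) != cr V (z j).
      rewrite -mem_wsep /wsep -/w; apply: (map_f (fun r => r ^ (z i)^-1)).
      by rewrite ww walls_cat mem_cat /= inE eqxx orbT.
    have [V0 Vn V0n Vij] := mono _ Vz.
    have nUV : ~ crossing S U V.
      move=> UV; move/negP: nAt; apply; apply/hasP; exists V; last by rewrite tV.
      exact/mem_transverse.
    have [b [b' nob]] : exists b b', forall y, cr U y = b -> cr V y != b'.
      apply: contrapT => no; apply: nUV => b b'; apply: contrapT => nob; apply: no.
      by exists b, b' => y Uy; apply/negP => /eqP Vy; apply: nob; exists y.
    have crossVW W x1 x2 : crossing S U W -> cr V x1 = b' -> cr V x2 = b' ->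
        cr W x1 != cr W x2 -> crossing S W V.
      move=> UW Vx1 Vx2 W12 c1 c2; have [->|c2b] := eqVneq c2 b'.
        have [W1|W1] := eqVneq (cr W x1) c1; first by exists x1.
        by exists x2; split=> //; apply: (neq_trans_bool W1); rewrite eq_sym.
      have [y [Uy Wy]] := UW b c1; exists y; split=> //.
      by apply: (neq_trans_bool (a := b')); [rewrite eq_sym|exact: nob].
    have [W Wrs /andP[sW Wij]] := hasP As.
    have [W0 Wn W0n _] := mono _ (rs_mono _ Wrs Wij).
    suff [W' [sW' W'V]] : exists W', parity S s W' /\ crossing S W' V.
      exact: (crossing_adjacent e_sym e_irr W'V sW' tV).
    have [Vb|Vb] := eqVneq (cr V (p 0%N)) b'.
      have : s \in th1 i.
        by rewrite th1ij inE; apply/hasP; exists W; rewrite ?sW //= Wn.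
      rewrite inE => /hasP[W' W'rs /andP[sW' W'0]]; exists W'; split=> //.
      by apply: (crossVW _ (p 0%N) (p i)); rewrite ?V0 //; exact: rs_cross.
    have {}Vb : cr V (p n) = b' by apply: (neq_trans_bool Vb); rewrite eq_sym.
    have : s \in th2 j.
      by rewrite -th2ij inE; apply/hasP; exists W; rewrite ?sW //= W0.
    rewrite inE => /hasP[W' W'rs /andP[sW' W'0]]; exists W'; split=> //.
    by apply: (crossVW _ (p j) (p n)); rewrite ?Vn //; exact: rs_cross.
  have h1 : p j * (p i)^-1 = 1.
    apply: (@join_trivial _ (z i) [seq s <- w | A s] [seq s <- w | ~~ A s] u s0).
    - by rewrite gpredM ?gpredV ?pH //; lia.
    - rewrite -ev_sort // ev_redw conjgE; congr (_ * _).
      by rewrite -(mulVKg (p i) (z i)) zij -mulgA mulKg mulVKg.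
    - by move=> s t; rewrite !mem_filter => /andP[As _] /andP[nAt tw]; exact: wA.
    - by move=> s; rewrite mem_filter => /andP[/Au].
    by move=> t; rewrite mem_filter => /andP[nAt tw]; rewrite e_sym; exact: wA.
  have := lBp i j (ltnW ij) jn; have -> : p j = p i by rewrite (divg1_eq h1).
  by rewrite mulVg lB1; lia.
have c0 : c 0%N = 0%N.
  by apply/eqP; rewrite -leqn0 leqNgt -has_count; apply/hasPn => W _; rewrite eqxx.
have cn : c n = size rs by apply/eqP; rewrite -all_count; apply/allP => W /rs_sep.
have cS i : (i < n)%N -> (c i.+1 <= c i + beta)%N.
  move=> i_n; apply: leq_trans (leq_add (leqnn _) (geo_step gp i_n)).
  pose B := [seq W <- rs | cr W (p i) != cr W (p i.+1)].
  apply: (@leq_trans (c i + size B)%N); last first.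
    rewrite leq_add2l; apply: size_le_dist; first exact: filter_uniq.
    by move=> W; rewrite mem_filter => /andP[].
  rewrite size_filter /c -count_predUI; apply: leq_trans (leq_addr _ _).
  by apply: sub_count => W /=; have [->|//] := eqVneq (cr W (p 0%N)) (cr W (p i)).
(* [idx m] is the first time at which [c] reaches [m * beta]. Since [c] gains at most [beta] per
   step, it is still below the next multiple, and distinct [m] give distinct counts. *)
have [idx idxP] : {idx : nat -> nat & forall m, (m <= size cols)%N ->
    [/\ idx m <= n, m * beta <= c (idx m) & c (idx m) < m.+1 * beta]%N}.
  apply: (@choice _ _ (fun m i => (m <= size cols)%N ->
    [/\ i <= n, m * beta <= c i & c i < m.+1 * beta]%N)) => m.
  have [mc|] := leqP m (size cols); last by exists 0%N.
  have ex : exists i, (i <= n)%N && (m * beta <= c i)%N.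
    exists n; rewrite leqnn cn; apply: leq_trans (ltnW big).
    by rewrite leq_mul2r mc orbT.
  exists (ex_minn ex) => _; case: ex_minnP => -[|l] /andP[l_n ml] lmin; split=> //.
    by rewrite c0 mulSn ltn_addr.
  have cl : (c l < m * beta)%N.
    rewrite ltnNge; apply/negP => mcl.
    by have := lmin l; rewrite (ltnW l_n) mcl ltnn => /(_ isT).
  by rewrite mulSn addnC; apply: leq_ltn_trans (cS l l_n) _; rewrite ltn_add2r.
have [|||m [m' [mi m'i mm' cmm']]] := @pigeonhole _ _ (color \o idx) (iota 0 (size cols).+1) cols.
- exact: iota_uniq.
- move=> m; rewrite mem_iota /= ltnS => mc; have [im _ _] := idxP m mc.
  apply/allpairsP; exists (((idx m %% D.+1)%N, th1 (idx m)), (th2 (idx m), (p (idx m))^-1 * z (idx m))).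
  split=> //; apply/allpairsP; first by exists ((idx m %% D.+1)%N, th1 (idx m)); rewrite mem_enum mem_iota /= ltn_mod.
  by exists (th2 (idx m), (p (idx m))^-1 * z (idx m)); rewrite mem_enum; split=> //; exact/mem_word_ball/zp.
- by rewrite size_iota.
move: mi m'i; rewrite !mem_iota /= !ltnS => /idxP[im mlo mhi] /idxP[im' m'lo m'hi].
have cne : c (idx m) <> c (idx m').
  move=> cc; rewrite -cc in m'lo m'hi; have : (m < m'.+1)%N && (m' < m.+1)%N.
    by rewrite -(ltn_pmul2r (ltn0Sn _ : 0 < beta)%N) (leq_ltn_trans mlo) //= -(ltn_pmul2r (ltn0Sn _ : 0 < beta)%N) (leq_ltn_trans m'lo).
  by move: mm'; lia.
have [lt|lt|eq] := ltngtP (idx m) (idx m'); last by rewrite eq in cne.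
  exact: (key _ _ lt im' cmm').
by apply: (key _ _ lt im) (esym cmm') _ => /esym.
Qed.

(* Since a wall crosses boundedly many pivots, pivots that are far apart along
   p are nested, and no wall crosses two of them. *)
Lemma neck_chain : exists2 L, (0 < L)%N & forall p n, geo p n ->
  exists Y : nat -> G,
    (forall k, (k.+1 * L <= n)%N -> pivot (Y k) p n (k * L) (k.+1 * L)) /\
    forall k, (k.+2 * L <= n)%N ->
      (forall x, beyond (p 0%N) (Y k.+1) x -> beyond (p 0%N) (Y k) x) /\
      (forall U, crossing S U (Y k) -> crossing S U (Y k.+1) -> False).
Proof.
have [M M0 MP] := pivot_ex; have [n0 n0P] := projection_bound.
exists ((5 * n0 + 4) * M)%N => [|p n gp]; first by rewrite muln_gt0 M0 addn_gt0 orbT.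
have [V VP] : {V : nat -> G & forall j, (j.+1 * M <= n)%N -> pivot (V j) p n (j * M) (j.+1 * M)}.
  apply: (@choice _ _ (fun j V => (j.+1 * M <= n)%N -> pivot V p n (j * M) (j.+1 * M))) => j.
  have [jn|] := leqP (j.+1 * M) n; last by exists 1.
  by have := MP p n (j * M)%N gp; rewrite addnC -mulSn => /(_ jn)[V VP]; exists V.
have mulM i j : (i <= j)%N -> (i * M <= j * M)%N by move=> ij; rewrite leq_mul2r ij orbT.
have few U ms : uniq ms -> (forall m, m \in ms -> (m.+1 * M <= n)%N /\ crossing S U (V m)) ->
    (size ms <= n0)%N.
  move=> ums msP; rewrite -(size_map V); apply: leq_trans (n0P U p n gp).
  apply: uniq_leq_size => [|_ /mapP[m /msP[mn UVm] ->]]; last first.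
    apply/mem_transverse; split=> //; have [_ /(_ n mn (leqnn n))] := VP m mn.
    by rewrite /beyond eq_sym.
  rewrite map_inj_in_uniq // => m m' /msP[mn _] /msP[m'n _] Vmm'.
  have lt i j : (i < j)%N -> (i.+1 * M <= n)%N -> (j.+1 * M <= n)%N -> V i = V j -> False.
    move=> ij i_n jn Vij; have [+ _] := VP j jn; have [_ +] := VP i i_n.
    rewrite Vij => /(_ (j * M)%N (mulM _ _ ij)) b /(_ (j * M)%N (leqnn _)).
    by rewrite b //; apply: leq_trans jn; exact: mulM.
  have [mm'|mm'|//] := ltngtP m m'; first by case: (lt _ _ mm' mn m'n).
  by case: (lt _ _ mm' m'n mn); exact/esym.
have nested i j : (i < j)%N -> (j.+1 * M <= n)%N -> ~ crossing S (V i) (V j) ->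
    forall x, beyond (p 0%N) (V j) x -> beyond (p 0%N) (V i) x.
  move=> ij jn; apply: (@pivot_nested _ _ _ n (i * M) (i.+1 * M) (j * M) (j.+1 * M)) => //.
  - exact: mulM.
  - exact: mulM.
  - by apply: VP; apply: leq_trans jn; apply: mulM; exact: ltnW.
  - exact: VP.
(* A pivot between two crossing pivots crosses one of them: otherwise nesting would put the
   halfspace of [V j] inside that of [V i]. Each of the two is crossed by at most [n0] pivots. *)
have close i j : (i < j)%N -> (j.+1 * M <= n)%N -> crossing S (V i) (V j) ->
    (j - i <= 2 * n0 + 1)%N.
  move=> ij jn cij; pose ms := iota i.+1 (j - i.+1).
  have msP m : m \in ms -> [/\ (i < m)%N, (m < j)%N & (m.+1 * M <= n)%N].
    rewrite mem_iota subnKC // => /andP[im mj]; split=> //.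
    by apply: leq_trans jn; apply: mulM; exact: ltnW.
  pose A := [seq m <- ms | `[< crossing S (V i) (V m) >]].
  pose B := [seq m <- ms | `[< crossing S (V j) (V m) >]].
  have sA : (size A <= n0)%N.
    apply: (few (V i)) => [|m]; first by rewrite filter_uniq ?iota_uniq.
    by rewrite mem_filter => /andP[/asboolP ? /msP[]].
  have sB : (size B <= n0)%N.
    apply: (few (V j)) => [|m]; first by rewrite filter_uniq ?iota_uniq.
    by rewrite mem_filter => /andP[/asboolP ? /msP[]].
  have : (size ms <= size (A ++ B))%N.
    apply: uniq_leq_size => [|m mms]; first exact: iota_uniq.
    have [im mj mn] := msP m mms; rewrite mem_cat !mem_filter mms !andbT.
    have [//|nim] := asboolP (crossing S (V i) (V m)).
    have [//|njm] := asboolP (crossing S (V j) (V m)).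
    have nmj : ~ crossing S (V m) (V j) by move/crossing_sym.
    move/(crossing_beyond (p 0%N)): cij => /(_ false true)[x [Vix Vjx]].
    by have := nested i m im mn nim x (nested m j mj jn nmj x Vjx); rewrite Vix.
  by rewrite size_cat size_iota; lia.
(* Pivots more than [2 * n0 + 1] indices away from both [i] and [j] are nested between them, so [U]
   crosses them too. There are at least [j - i - 4 * n0 - 3] of these and at most [n0], whence the
   spacing [5 * n0 + 4]. *)
have separated U i j : (i < j)%N -> (j.+1 * M <= n)%N -> crossing S U (V i) ->
    crossing S U (V j) -> (j - i <= 5 * n0 + 3)%N.
  move=> ij jn Ui Uj; pose ms := iota (i + 2 * n0 + 2) (j - i - 4 * n0 - 3).
  suff : (size ms <= n0)%N by rewrite size_iota; lia.
  apply: (few U) => [|m]; first exact: iota_uniq.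
  rewrite mem_iota => mP.
  have mn : (m.+1 * M <= n)%N by apply: leq_trans jn; apply: mulM; lia.
  split=> //; apply: (@crossing_between (p 0%N) U (V i) (V m) (V j)) => //; apply: nested => //.
  - by lia.
  - by move/close => /(_ _ mn) mi; have := mi _; lia.
  - by lia.
  - by move/close => /(_ _ jn) mi; have := mi _; lia.
exists (fun k => V (k * (5 * n0 + 4))%N); set sp := (5 * n0 + 4)%N.
have spE k : (k.+1 * (sp * M) = (k * sp + sp) * M)%N by rewrite mulnA mulSn addnC.
split=> [k|k]; rewrite ?spE => kn.
  have kn' : ((k * sp).+1 * M <= n)%N by apply: leq_trans kn; apply: mulM; rewrite /sp; lia.
  have [Va Vb] := VP _ kn'; split=> l; first by rewrite mulnA; exact: Va.
  by move=> kl; apply: Vb; apply: leq_trans kl; apply: mulM; rewrite /sp; lia.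
have kn' : ((k.+1 * sp).+1 * M <= n)%N by apply: leq_trans kn; apply: mulM; rewrite /sp; lia.
have lt : (k * sp < k.+1 * sp)%N by rewrite ltn_mul2r ltnSn /sp; lia.
split=> [|U Uk UkS].
  apply: nested => // /close; rewrite mulSn addnK => /(_ lt kn'); rewrite /sp; lia.
by have := separated U _ _ lt kn' Uk UkS; rewrite mulSn addnK /sp; lia.
Qed.

End Subgroup.

Lemma last_time (b : pred nat) N : b 0%N -> ~~ b N ->
  exists t, [/\ (t < N)%N, b t & forall i, (t < i)%N -> (i <= N)%N -> ~~ b i].
Proof.
move=> b0; elim: N => [|N IH]; first by rewrite b0.
have [bN bSN|/IH[t [tN bt tP]] bSN] := boolP (b N).
  by exists N; split=> // i Ni iN; have -> : i = N.+1 by lia.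
exists t; split=> // [|i ti]; first exact: ltnW.
by rewrite leq_eqVlt => /orP[/eqP->//|]; exact: tP.
Qed.

(* The numerical core of the Morse lemma: along a run of indices with R > rho,
   the time spent grows faster than the distance travelled. *)
Lemma excursion_bound lam E1 E2 K C : exists B, forall m (tau R : nat -> nat),
  R 0%N = 0%N -> R m = 0%N -> (forall k, (k < m)%N -> (tau k <= tau k.+1)%N) ->
  (forall k, (k < m)%N -> (R k + R k.+1 <= lam * (tau k.+1 - tau k) + E1)%N) ->
  (forall k l, (k <= l)%N -> (l <= m)%N ->
     (tau l - tau k <= K * (R k + R l + (l - k) * E2) + C)%N) ->
  forall k, (k <= m)%N -> (R k <= B)%N.
Proof.
(* On a run from [k] to [l] with [R] above [rho] strictly inside, [(l - k) * rho <= lam * (tau l -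
   tau k) + (l - k) * E1], while [tau l - tau k] is at most [K * (2 * rho + (l - k) * E2) + C]. As
   [rho] exceeds [lam * K * E2 + E1], the two bound [l - k] by [B1]. *)
pose rho := (2 * (lam * K * E2 + E1)).+1; pose B1 := (2 * lam * K * rho + lam * C)%N.
exists (lam * (K * (2 * rho + B1 * E2) + C) + B1 * E1 + rho)%N => m tau R R0 Rm mono step qi j jm.
have [Rj|Rj] := leqP (R j) rho; first by apply: leq_trans Rj _; exact: leq_addl.
have tau_mono i l : (i <= l)%N -> (l <= m)%N -> (tau i <= tau l)%N.
  elim: l => [|l IH]; first by rewrite leqn0 => /eqP->.
  rewrite leq_eqVlt => /orP[/eqP->//|/ltnSE il] lm.
  exact: leq_trans (IH il (ltnW lm)) (mono l lm).
have [k [kj Rk kP]] : exists k, [/\ (k < j)%N, (R k <= rho)%N & forall i, (k < i <= j)%N -> (rho < R i)%N].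
  have [||k [kj Rk kP]] := @last_time (fun i => R i <= rho)%N j; rewrite ?R0 -?ltnNge //.
  by exists k; split=> // i /andP[ki ij]; rewrite ltnNge kP.
have [t' [t'm Rt t'P]] : exists t, [/\ (t < m - j)%N, (R (m - t) <= rho)%N
    & forall i, (j <= i < m - t)%N -> (rho < R i)%N].
  have [t [tm tP tmin]] : exists t, [/\ (t < m - j)%N, (R (m - t) <= rho)%N
      & forall i, (t < i)%N -> (i <= m - j)%N -> (rho < R (m - i))%N].
    have [||t [tm Rt tP]] := @last_time (fun i => R (m - i) <= rho)%N (m - j);
      rewrite ?subn0 ?Rm ?subKn -?ltnNge //.
    by exists t; split=> // i ti ij; rewrite ltnNge tP.
  exists t; split=> // i /andP[ji im].
  by have := tmin (m - i)%N; rewrite subKn; [apply; lia|lia].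
pose l := (m - t')%N; have jl : (j < l)%N by rewrite /l; lia.
have lm : (l <= m)%N by exact: leq_subr.
have long i : (k + i <= l)%N -> (i * rho <= lam * (tau (k + i) - tau k) + i * E1)%N.
  elim: i => [|i IH] kil; first by rewrite mul0n.
  rewrite addnS in kil *; have := IH (ltnW kil); have kim : (k + i < m)%N by lia.
  have := step _ kim; have := tau_mono k (k + i)%N (leq_addr _ _) (ltnW kim).
  have := mono _ kim.
  have : (rho <= R (k + i) + R (k + i).+1)%N.
    have [ji|ij] := leqP j (k + i)%N.
      by apply: leq_trans (leq_addr _ _); apply/ltnW/t'P; rewrite ji /=; exact: kil.
    by apply: leq_trans (leq_addl _ _); apply/ltnW/kP; lia.
  move: (R _) (R _) (tau _) (tau _) (tau _) => a b x y z0; nia.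
have kl : (k <= l)%N by lia.
have dur := qi k l kl lm; have := long (l - k)%N; rewrite subnKC // => /(_ (leqnn _)) tot.
have dur' : (tau l - tau k <= K * (2 * rho + (l - k) * E2) + C)%N.
  apply: leq_trans dur _; rewrite leq_add2r leq_mul2l leq_add2r; apply/orP; right.
  by rewrite mul2n -addnn leq_add.
have lkB : (l - k <= B1)%N.
  have := leq_mul (leqnn lam) dur'; move: tot; rewrite /B1 /rho.
  move: (l - k)%N (tau l - tau k)%N => a b; nia.
have j1 : (j.-1.+1 = j)%N by rewrite prednK // (leq_ltn_trans _ kj).
have := step j.-1; rewrite j1 => /(_ jm) stepj.
have tj : (tau j - tau j.-1 <= tau l - tau k)%N.
  by have := tau_mono j l (ltnW jl) lm; have := tau_mono k j.-1; lia.
have mB : (lam * (tau j - tau j.-1) <= lam * (K * (2 * rho + B1 * E2) + C))%N.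
  rewrite leq_mul2l; apply/orP; right; apply: leq_trans tj _; apply: leq_trans dur' _.
  by rewrite leq_add2r leq_mul2l leq_add2l leq_mul2r lkB !orbT.
have B1E : (E1 <= B1 * E1)%N by apply: leq_pmull; lia.
lia.
Qed.

(** * The Morse property *)

Section Morse.
Variables (T : finType) (e : rel T).
Hypotheses (e_sym : symmetric e) (e_irr : irreflexive e).
Variables (G : groupType) (S : coxeter_presentation e G) (H : groupClosed G).
Hypothesis H_cent : forall h g, h \in H -> h != 1 -> g * h = h * g -> g \in H.
Hypothesis H_refl : forall s g, S s ^ g \notin H.
Variables (bs : seq G) (lB : G -> nat).
Hypothesis lB1 : lB 1 = 0%N.
Implicit Types (s t : T) (w : seq T) (r g h x y z : G).

Local Notation cr := (crosses S).
Local Notation d := (dist S).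
Local Notation geo := (geo H bs lB).

(** Consider a wall separating the middle vertex from both [u] and [v]. If [p] crosses it on both
    sides of that vertex, it does so within time [D]. Otherwise the wall crosses one of [Y k],
    [Y k.+1], hence not the other, and this forces [p] to cross it inside the two windows. So few
    walls cause a detour. *)
Lemma necks : exists L E, (0 < L)%N /\ forall p n, geo p n ->
  exists Y : nat -> G, [/\
    forall k, (k.+1 * L <= n)%N -> pivot S (Y k) p n (k * L) (k.+1 * L),
    forall k, (k.+2 * L <= n)%N ->
      forall x, beyond S (p 0%N) (Y k.+1) x -> beyond S (p 0%N) (Y k) x
    & forall k u v, (k.+2 * L <= n)%N ->
      ~~ beyond S (p 0%N) (Y k) u -> beyond S (p 0%N) (Y k.+1) v ->
      (d u (p (k.+1 * L)%N) + d (p (k.+1 * L)%N) v <= d u v + 2 * E)%N].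
Proof.
have [L L0 LP] := neck_chain e_sym e_irr H_cent H_refl bs lB1.
have [D DP] := recross_bound H_cent H_refl bs lB.
exists L, ((2 * L + D) * beta S bs)%N; split=> // p n gp; have [Y [piv sep]] := LP p n gp.
exists Y; split=> // [k kn|k u v kn]; first by have [] := sep k kn.
have [nest ssep] := sep k kn; move: kn; set b := (k.+2 * L)%N => bn.
set c := (k.+1 * L)%N; set a := (k * L)%N.
have bE : (b = c + L)%N by rewrite /b mulSn addnC.
have cE : (c = a + L)%N by rewrite /c mulSn addnC.
have cn : (c <= n)%N by lia.
have ac : (a <= c)%N by rewrite cE leq_addr.
have cb : (c <= b)%N by rewrite bE leq_addr.
have [Ya Yb] : pivot S (Y k) p n a c := piv k cn.
have [Y'a Y'b] : pivot S (Y k.+1) p n c b := piv k.+1 bn.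
clearbody a b c.
move=> Yu Y'v; have Y'u : ~~ beyond S (p 0%N) (Y k.+1) u by apply: contra Yu => /nest.
have Yv := nest _ Y'v; have Yz := Yb c (leqnn _) cn; have Y'z := Y'a c (leqnn _).
have Y0 := Ya 0%N (leq0n _); have Y'n := Y'b n bn (leqnn _).
pose tr := track S p a b ++ track S p (c - D) c.
apply: (@leq_trans (d u v + 2 * size tr)%N); last first.
  rewrite leq_add2l leq_mul2l /= size_cat mulnDl; apply: leq_add.
    by apply: leq_trans (size_track S _ gp _) _ => //; rewrite leq_mul2r; lia.
  by apply: leq_trans (size_track S _ gp _) _ => //; rewrite leq_mul2r; lia.
apply: dist_add_le => r ruz rvz; rewrite mem_cat.
have in1 i j : (a <= i)%N -> (i <= j)%N -> (j <= b)%N -> cr r (p i) != cr r (p j) ->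
    (r \in track S p a b) || (r \in track S p (c - D) c).
  move=> ai ij jb rij; have [l [il lj rl]] := @change_step _ (fun l => cr r (p l)) _ _ ij rij.
  have -> // : r \in track S p a b.
  exact: mem_track (leq_trans ai il) (leq_trans lj jb) rl.
have [r0|r0] := eqVneq (cr r (p 0%N)) (cr r (p c)).
  have Ru : beyond S (p 0%N) r u by rewrite /beyond r0.
  have Rv : beyond S (p 0%N) r v by rewrite /beyond r0.
  have Rz : ~~ beyond S (p 0%N) r (p c) by rewrite /beyond r0 eqxx.
  have R0 : ~~ beyond S (p 0%N) r (p 0%N) by rewrite /beyond eqxx.
  have RY := crossing_sym (crossing4 Y0 R0 Yu Ru Yz Rz Yv Rv).
  apply: (in1 c b) => //.
  apply/negP => rb; apply: (ssep r RY).
  have Rb : ~~ beyond S (p 0%N) r (p b) by rewrite /beyond -(eqP rb) r0 eqxx.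
  exact: crossing_sym (crossing4 Y'z Rz Y'u Ru (Y'b b (leqnn _) bn) Rb Y'v Rv).
have Rz : beyond S (p 0%N) r (p c) by rewrite /beyond eq_sym.
have Ru : ~~ beyond S (p 0%N) r u.
  by rewrite /beyond; move: r0 ruz; case: (cr r _); case: (cr r _); case: (cr r _).
have Rv : ~~ beyond S (p 0%N) r v.
  by rewrite /beyond; move: r0 rvz; case: (cr r _); case: (cr r _); case: (cr r _).
have [rn|rn] := eqVneq (cr r (p n)) (cr r (p c)).
  have Rn : beyond S (p 0%N) r (p n) by rewrite /beyond rn.
  have RY' := crossing_sym (crossing4 Y'u Ru Y'z Rz Y'v Rv Y'n Rn).
  apply: (in1 a c) => //.
  apply/negP => ra; apply: (ssep r _ RY').
  have Ra : beyond S (p 0%N) r (p a) by rewrite /beyond (eqP ra).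
  exact: crossing_sym (crossing4 Yu Ru (Ya a (leqnn _)) Ra Yv Rv Yz Rz).
have [i [_ ic ri]] := @change_step _ (fun l => cr r (p l)) _ _ (leq0n _) r0.
rewrite eq_sym in rn.
have [j [cj jn rj]] := @change_step _ (fun l => cr r (p l)) _ _ cn rn.
have ij : (i <= j)%N by exact: ltnW (leq_trans ic cj).
have Dij := DP p n r i j gp ij jn ri rj.
apply/orP; right; apply: (mem_track _ ic ri).
by rewrite leq_subLR addnC (leq_trans cj) // -leq_subLR.
Qed.

Lemma path_dist (q : nat -> G) lam N i j :
  (forall i, (i < N)%N -> (d (q i) (q i.+1) <= lam)%N) ->
  (i <= j)%N -> (j <= N)%N -> (d (q i) (q j) <= lam * (j - i))%N.
Proof.
move=> qlam; elim: j => [|j IH]; first by rewrite leqn0 => /eqP-> _; rewrite distxx.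
rewrite leq_eqVlt => /orP[/eqP->|/ltnSE ij] jN; first by rewrite distxx.
have := dist_tri S (q j) (q i) (q j.+1); have := qlam j jN.
by have := IH ij (ltnW jN); rewrite subSn // mulnS; lia.
Qed.

(** [Z] depends on [p] and not on [q], so that two quasi-geodesics with common ends are both close
    to the same set; stability rests on this. *)
Lemma discrete_morse lam K C : exists M, forall p n, geo p n ->
  exists Z : seq G, (forall z, z \in Z -> z \in H) /\
  forall N (q : nat -> G), q 0%N = p 0%N -> q N = p n ->
    (forall i, (i < N)%N -> (d (q i) (q i.+1) <= lam)%N) ->
    (forall i j, (i <= j)%N -> (j <= N)%N -> (j - i <= K * d (q i) (q j) + C)%N) ->
    (forall i, (i <= N)%N -> exists2 z, z \in Z & (d (q i) z <= M)%N) /\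
    (forall z, z \in Z -> exists2 i, (i <= N)%N & (d (q i) z <= M)%N).
Proof.
have [L [E [L0 neck]]] := necks; set b := beta S bs.
have [B BP] := excursion_bound lam (2 * lam + 2 * E + L * b) (L * b) K C.
exists (lam * (K * (2 * B + L * b) + C) + B)%N => p n gp.
have [Y [piv nest neckP]] := neck p n gp; have [pH _ _] := gp.
pose m := n %/ L; pose zt k := p (minn (k * L) n).
have mn k : (k < m)%N -> (k.+1 * L <= n)%N by rewrite leq_divRL.
have zt_dist k l : (k <= l)%N -> (d (zt k) (zt l) <= (l - k) * (L * b))%N.
  move=> kl; apply: leq_trans (geo_dist S gp _ (geq_minr _ _)) _.
    by have : (k * L <= l * L)%N by [rewrite leq_mul2r kl orbT]; lia.
  by rewrite mulnA leq_mul2r mulnBl; apply/orP; right; lia.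
exists [seq zt k | k <- iota 0 m.+2]; split=> [_ /mapP[k _ ->]|N q q0 qN qlam qK].
  by apply: pH; exact: geq_minr.
have [t tP] : {t : nat -> nat & forall k, (k < m)%N -> [/\ (t k < N)%N,
    ~~ beyond S (p 0%N) (Y k) (q (t k))
    & forall i, (t k < i)%N -> (i <= N)%N -> beyond S (p 0%N) (Y k) (q i)]}.
  apply: (@choice _ _ (fun k u => (k < m)%N -> [/\ (u < N)%N,
    ~~ beyond S (p 0%N) (Y k) (q u)
    & forall i, (u < i)%N -> (i <= N)%N -> beyond S (p 0%N) (Y k) (q i)])) => k.
  have [km|] := ltnP k m; last by exists 0%N.
  have [Ya Yb] := piv k (mn k km).
  have [||u [uN uk uP]] := @last_time (fun i => ~~ beyond S (p 0%N) (Y k) (q i)) N.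
  - by rewrite q0 Ya.
  - by rewrite qN negbK Yb // mn.
  by exists u => _; split=> // i ui iN; rewrite -[beyond _ _ _ _]negbK uP.
(* The index is shifted by one: [tau k.+1], the last time at which [q] is not beyond [Y k], is
   compared with the vertex [zt k.+1] just behind that pivot. The values at [0] and [m.+1] are the
   ends of [q], where [R] vanishes. *)
pose tau k := if k is k'.+1 then if (k' < m)%N then t k' else N else 0%N.
pose R k := d (q (tau k)) (zt k).
have zt0 : zt 0%N = p 0%N by rewrite /zt mul0n min0n.
have ztm : zt m.+1 = p n by rewrite /zt (minn_idPr _) // ltnW // ltn_ceil.
have taum : tau m.+1 = N by rewrite /= ltnn.
have tau_le k : (k <= m.+1)%N -> (tau k <= N)%N.
  by case: k => //= k _; case: ifP => // /tP[/ltnW].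
have mono k : (k < m.+1)%N -> (tau k <= tau k.+1)%N.
  case: k => [|k] //; rewrite ltnS => km; rewrite /= km.
  have [tkN tk tkP] := tP k km; case: ifP => [k1m|_]; last exact: ltnW.
  have [tk'N _ tk'P] := tP _ k1m; rewrite leqNgt; apply/negP => lt.
  by move/negP: tk; apply; apply: nest (mn _ k1m) _ (tk'P _ lt (ltnW tkN)).
have step k : (k < m.+1)%N -> (R k + R k.+1 <= lam * (tau k.+1 - tau k) + (2 * lam + 2 * E + L * b))%N.
  have zS : (d (zt k) (zt k.+1) <= L * b)%N.
    by have := zt_dist k k.+1 (leqnSn _); rewrite subSn // subnn mul1n.
  move=> km; have qq := path_dist qlam (mono k km) (tau_le k.+1 km).
  case: k => [|k] in km zS qq *.
    rewrite /R [tau 0%N]/= q0 zt0 distxx add0n.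
    have := dist_tri S (p 0%N) (q (tau 1%N)) (zt 1%N); rewrite (distC S (q (tau 1%N)) (p 0%N)).
    by move: zS qq; rewrite zt0 [tau 0%N]/= q0; lia.
  have [ek|nk] := eqVneq k.+1 m.
    rewrite /R ek taum qN ztm distxx addn0 -ek.
    have := dist_tri S (p n) (q (tau k.+1)) (zt k.+1); rewrite (distC _ (p n)).
    by move: zS qq; rewrite ek taum qN ztm -ek; lia.
  have km' : (k.+1 < m)%N by rewrite ltn_neqAle nk.
  have [tN tk tkP] := tP k (ltnW km'); have [t'N tk' tk'P] := tP k.+1 km'.
  have vb := tk'P _ (ltnSn _) t'N; have := neckP k _ _ (mn _ km') tk vb.
  have ztk : zt k.+1 = p (k.+1 * L)%N by rewrite /zt (minn_idPl _) // mn // ltnW.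
  rewrite -ztk /R.
  have E1 : tau k.+1 = t k by rewrite /= ltnW.
  have E2 : tau k.+2 = t k.+1 by rewrite /= km'.
  rewrite E1 E2; have := qlam _ t'N.
  have := dist_tri S (q (t k.+1).+1) (q (t k.+1)) (zt k.+1).
  have := dist_tri S (zt k.+1) (q (t k.+1)) (zt k.+2).
  have := dist_tri S (q (t k.+1)) (q (t k)) (q (t k.+1).+1).
  rewrite (distC _ (q (t k.+1).+1) (zt _)); rewrite E1 E2 in qq; lia.
have qi k l : (k <= l)%N -> (l <= m.+1)%N ->
    (tau l - tau k <= K * (R k + R l + (l - k) * (L * b)) + C)%N.
  move=> kl lm.
  have tkl : (tau k <= tau l)%N.
    elim: l kl lm => [|l IH]; first by rewrite leqn0 => /eqP->.
    rewrite leq_eqVlt => /orP[/eqP->//|/ltnSE kl] lm.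
    exact: leq_trans (IH kl (ltnW lm)) (mono l lm).
  apply: leq_trans (qK _ _ tkl (tau_le l lm)) _; rewrite leq_add2r leq_mul2l; apply/orP; right.
  have := dist_tri S (zt k) (q (tau k)) (q (tau l)).
  have := dist_tri S (zt l) (zt k) (q (tau l)).
  by have := zt_dist k l kl; rewrite /R (distC _ (zt l)); lia.
have RB k : (k <= m.+1)%N -> (R k <= B)%N.
  apply: BP mono step qi k.
    by rewrite /R zt0 q0 distxx.
  by rewrite /R taum ztm qN distxx.
split=> [i iN|_ /mapP[k km ->]]; last first.
  rewrite mem_iota /= ltnS in km; exists (tau k); first exact: tau_le.
  by apply: leq_trans (RB k km) _; exact: leq_addl.
have [k km ki] : exists2 k, (k <= m)%N & (tau k <= i <= tau k.+1)%N.
  suff find l : (l <= m.+1)%N -> (i <= tau l)%N ->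
      exists2 k, (k <= m)%N & (tau k <= i <= tau k.+1)%N.
    by apply: (find m.+1) => //; rewrite taum.
  elim: l => [|l IH] lm; first by rewrite leqn0 => /eqP->; exists 0%N.
  have [il _|li il] := leqP i (tau l); first by apply: IH => //; exact: ltnW.
  by exists l => //; rewrite (ltnW li).
exists (zt k); first by apply: map_f; rewrite mem_iota /= ltnS; exact: ltnW.
have /andP[ki1 ki2] := ki; have := dist_tri S (q (tau k)) (q i) (zt k).
rewrite (distC S (q i) (q (tau k))); have := path_dist qlam ki1 iN.
have := RB k (leqW km); rewrite /R => RBk.
have : (lam * (i - tau k) <= lam * (K * (2 * B + L * b) + C))%N.
  rewrite leq_mul2l; apply/orP; right; apply: leq_trans (_ : _ <= tau k.+1 - tau k)%N _.
    by rewrite leq_sub2r.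
  apply: leq_trans (qi k k.+1 (leqnSn _) km) _; rewrite leq_add2r leq_mul2l; apply/orP; right.
  have := RB k.+1 km; have := RB k (leqW km); rewrite subSn // subnn mul1n; lia.
lia.
Qed.

(** The windows of length [L] have pairwise distinct pivots, each of which separates the ends of
    [p]. *)
Lemma linear_divergence : exists2 L, (0 < L)%N & forall p n, geo p n ->
  (n <= L * d (p 0%N) (p n) + L)%N.
Proof.
have [L L0 LP] := neck_chain e_sym e_irr H_cent H_refl bs lB1.
exists L => // p n gp; have [Y [piv _]] := LP p n gp.
pose m := n %/ L; have mn k : (k < m)%N -> (k.+1 * L <= n)%N by rewrite leq_divRL.
have : (m <= d (p 0%N) (p n))%N.
  rewrite -[m](size_iota 0) -(size_map Y); apply: size_le_dist => [|_ /mapP[k km ->]]; last first.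
    rewrite mem_iota /= in km; have [_ Yb] := piv k (mn k km).
    by rewrite eq_sym; apply: Yb => //; exact: mn.
  rewrite map_inj_in_uniq ?iota_uniq // => k l; rewrite !mem_iota /= => km lm.
  have lt i j : (i < j)%N -> (j < m)%N -> Y i <> Y j.
    move=> ij jm Yij; have [_ Yb] := piv i (mn i (ltn_trans ij jm)).
    have [Ya _] := piv j (mn j jm); have := Ya (i.+1 * L)%N; rewrite leq_mul2r ij orbT => /(_ isT).
    by rewrite -Yij Yb // mn // (ltn_trans ij).
  by case: (ltngtP k l) => // [/lt/(_ lm)|/lt/(_ km) + /esym].
move=> mle; have := divn_eq n L; have := ltn_mod n L; rewrite L0 -/m => lt nE.
have : (m * L <= d (p 0%N) (p n) * L)%N by rewrite leq_mul2r mle orbT.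
lia.
Qed.

End Morse.

(** * An invariant spanning tree *)

Section Tree.
Variables (T : finType) (e : rel T).
Hypotheses (e_sym : symmetric e) (e_irr : irreflexive e).
Variables (G : groupType) (S : coxeter_presentation e G) (H : groupClosed G).
Hypothesis H_cent : forall h g, h \in H -> h != 1 -> g * h = h * g -> g \in H.
Hypothesis H_refl : forall s g, S s ^ g \notin H.
Implicit Types (s t : T) (w : seq T) (r g h x y z : G).

Local Notation ev := (ev S).

Definition rank t : nat := enum_rank t.

(* The types of the edges of the Cayley graph dual to the wall of s inside the
   coset spanned by the generators of rank at least that of s. *)
Definition above s : pred T := [pred t | (t == s) || e s t && (rank s < rank t)].

(** The edges with letter [s] at related vertices are dual to the same wall, by [related_commute].
    As [s] is in [above s], both ends of such an edge are related. *)
Definition related s x y : Prop :=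
  exists w, {subset w <= above s} /\ y = x * ev w.

Lemma related_refl s x : related s x x.
Proof. by exists [::]; rewrite ev_nil mulg1. Qed.

Lemma related_sym s x y : related s x y -> related s y x.
Proof.
move=> [w [ws ->]]; exists (rev w); split=> [t|]; first by rewrite mem_rev => /ws.
by rewrite ev_rev mulgK.
Qed.

Lemma related_trans s x y z : related s x y -> related s y z -> related s x z.
Proof.
move=> [w [ws ->]] [w' [w's ->]]; exists (w ++ w'); split; last by rewrite ev_cat mulgA.
by move=> t; rewrite mem_cat => /orP[/ws|/w's].
Qed.

Lemma related_mul s g x y : related s x y -> related s (g * x) (g * y).
Proof. by move=> [w [ws ->]]; exists w; rewrite mulgA. Qed.

Lemma related_gen s x : related s x (x * S s).
Proof.
exists [:: s]; rewrite ev1; split=> // t; rewrite inE => /eqP->.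
by rewrite inE eqxx.
Qed.

Lemma related_commute s x y : related s x y -> S s * (x^-1 * y) = x^-1 * y * S s.
Proof.
move=> [w [ws ->]]; rewrite mulKg; elim: w ws => [|t w IH] ws.
  by rewrite ev_nil mulg1 mul1g.
rewrite ev_cons mulgA (_ : S s * S t = S t * S s).
  by rewrite -!mulgA IH // => u uw; apply: ws; rewrite inE uw orbT.
have := ws t; rewrite !inE eqxx => /(_ isT)/orP[/eqP->//|/andP[est _]].
exact: gen_comm.
Qed.

Definition similar s x y : Prop := exists2 h, h \in H & related s (h * x) y.

Lemma similar_ex s x : exists y, `[< similar s x y >].
Proof. by exists x; apply/asboolP; exists 1; [exact: gpred1|rewrite mul1g; exact: related_refl]. Qed.

(** [xchoose] depends on the predicate alone, so similar elements get the same representative. *)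
Definition rep s x : G := xchoose (similar_ex s x).

Lemma rep_similar s x : similar s x (rep s x).
Proof. exact/asboolP/(xchooseP (similar_ex s x)). Qed.

Lemma rep_eq s x y : similar s x y -> rep s x = rep s y.
Proof.
move=> [h hH hxy]; apply: eq_xchoose => z; apply/asbool_equiv_eq; split=> -[k kH kz].
  exists (k * h^-1); first by rewrite gpredM // gpredV.
  apply: related_trans kz; have := related_mul (k * h^-1) (related_sym hxy).
  by rewrite mulgA mulgVK.
exists (k * h); first by rewrite gpredM.
by apply: related_trans kz; rewrite -mulgA; exact: related_mul.
Qed.

(* An H-invariant choice of one oriented edge in each class of dual edges. *)
Definition marked s x : bool := `[< exists2 h, h \in H & x = h * rep s x >].

Lemma marked_mul s h x : h \in H -> marked s (h * x) = marked s x.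
Proof.
move=> hH; have E : rep s (h * x) = rep s x.
  by apply/esym/rep_eq; exists h => //; exact: related_refl.
apply/asbool_equiv_eq; rewrite E; split=> -[k kH kE].
  exists (h^-1 * k); first by rewrite gpredM // gpredV.
  by rewrite -mulgA -kE mulKg.
by exists (h * k); rewrite ?gpredM // -mulgA -kE.
Qed.

Lemma marked_ex s x : exists2 y, related s x y & marked s y.
Proof.
have [h hH hx] := rep_similar s x; exists (h^-1 * rep s x).
  by have := related_mul h^-1 hx; rewrite mulKg.
apply/asboolP; exists h^-1; first by rewrite gpredV.
congr (_ * _); apply/rep_eq; exists 1; first exact: gpred1.
by rewrite mul1g; have := related_mul h^-1 hx; rewrite mulKg.
Qed.

(** Both are translates of one representative, by [h] and [k] in [H]; then [h^-1 * k] fixes the wall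
    dual to the edge there, so it is 1. *)
Lemma marked_uniq s x y : related s x y -> marked s x -> marked s y -> x = y.
Proof.
move=> xy /asboolP[h hH xE] /asboolP[k kH yE].
have E : rep s x = rep s y by apply: rep_eq; exists 1; [exact: gpred1|rewrite mul1g].
have := related_commute xy; rewrite {}xE {}yE {}E; set c := rep s y.
have -> : (h * c)^-1 * (k * c) = (h^-1 * k) ^ c by gsimp.
move=> comm; have hk1 : h^-1 * k = 1.
  apply: (refl_stab H_cent H_refl (s := s) (g := c^-1)); first by rewrite gpredM ?gpredV.
  by apply: (conjg_inj c); rewrite (conjMg (S s ^ _)) (conjMg _ (S s ^ _)) conjgKV.
by rewrite -(mulg1_eq hk1) invgK.
Qed.

Definition edge s x : bool := marked s x || marked s (x * S s).

Lemma edge_mul s h x : h \in H -> edge s (h * x) = edge s x.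
Proof. by move=> hH; rewrite /edge -mulgA !(marked_mul _ _ hH). Qed.

Lemma edge_sym s x : edge s (x * S s) = edge s x.
Proof. by rewrite /edge genKr orbC. Qed.

Fixpoint treepath x w : bool :=
  if w is s :: w' then edge s x && treepath (x * S s) w' else true.

Lemma treepath_mul h x w : h \in H -> treepath (h * x) w = treepath x w.
Proof.
by move=> hH; elim: w x => //= s w IH x; rewrite (edge_mul _ _ hH) -mulgA IH.
Qed.

Lemma treepath_cat x w1 w2 :
  treepath x (w1 ++ w2) = treepath x w1 && treepath (x * ev w1) w2.
Proof.
elim: w1 x => [|s w1 IH] x /=; first by rewrite ev_nil mulg1.
by rewrite IH ev_cons mulgA andbA.
Qed.

Lemma treepath_rev x w : treepath x w -> treepath (x * ev w) (rev w).
Proof.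
elim: w x => //= s w IH x /andP[ex xw]; rewrite rev_cons -cats1 treepath_cat.
rewrite ev_cons mulgA IH //= andbT ev_rev mulgK edge_sym //.
Qed.

Definition linked x y : Prop := exists2 w, treepath x w & y = x * ev w.

Lemma linked_refl x : linked x x.
Proof. by exists [::]; rewrite ?ev_nil ?mulg1. Qed.

Lemma linked_sym x y : linked x y -> linked y x.
Proof. by move=> [w xw ->]; exists (rev w); rewrite ?treepath_rev // ev_rev mulgK. Qed.

Lemma linked_trans x y z : linked x y -> linked y z -> linked x z.
Proof.
move=> [w xw ->] [w' xw' ->]; exists (w ++ w'); first by rewrite treepath_cat xw.
by rewrite ev_cat mulgA.
Qed.

Lemma above_split s w : {subset w <= above s} -> exists v,
  {in v, forall t, e s t && (rank s < rank t)} /\ (ev w = ev v \/ ev w = S s * ev v).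
Proof.
elim: w => [|t w IH] ws; first by exists [::]; split=> //; left.
have [|v [vs vE]] := IH; first by move=> u uw; apply: ws; rewrite inE uw orbT.
have := ws t; rewrite !inE eqxx => /(_ isT)/orP[/eqP->|est].
  by exists v; split=> //; rewrite ev_cons; case: vE => ->; [right|left; rewrite genK].
exists (t :: v); split; first by move=> u; rewrite inE => /orP[/eqP->|/vs].
rewrite !ev_cons; case: vE => ->; [by left|right].
by rewrite !mulgA (gen_comm S (s := t)) // e_sym; case/andP: est.
Qed.

(** Induction on how many top ranks are allowed. To move along a letter [t], go to the marked edge
    of the class by a word of higher rank commuting with [S t], cross the edge, and return along the
    reversed word. *)
Lemma tree_connected x y : linked x y.
Proof.
have conn n : forall w z, {in w, forall t, (#|T| <= rank t + n)%N} -> linked z (z * ev w).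
  elim: n => [|n IHn] w z wn.
    case: w wn => [|t w] wn; first by rewrite ev_nil mulg1; exact: linked_refl.
    by have := wn t; rewrite inE eqxx addn0 leqNgt ltn_ord => /(_ isT).
  elim: w z wn => [|t w IHw] z wn; first by rewrite ev_nil mulg1; exact: linked_refl.
  rewrite ev_cons mulgA; apply: linked_trans (IHw _ _); last first.
    by move=> u uw; apply: wn; rewrite inE uw orbT.
  have [_ [w' [w't ->]] mark] := marked_ex t z.
  have [v [vt vE]] := above_split w't.
  have up u : linked u (u * ev v).
    apply: IHn => s /vt/andP[_ ts]; have := wn t; rewrite inE eqxx => /(_ isT); lia.
  have comm : S t * ev v = ev v * S t by apply: ev_comm => s /vt; rewrite e_sym => /andP[].
  case: vE mark => -> mark.
    apply: linked_trans (up z) _; apply: (@linked_trans _ (z * S t * ev v)).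
      exists [:: t]; rewrite /= ?andbT /edge ?mark // ev1 -!mulgA comm //.
    exact/linked_sym/up.
  apply: linked_sym; apply: linked_trans (up _) _; apply: (@linked_trans _ (z * ev v)).
    exists [:: t]; first by rewrite /= andbT /edge -(mulgA z) mark.
    by rewrite ev1 -!mulgA -comm genK.
  exact/linked_sym/up.
have [w wE] := gen_words S (x^-1 * y); rewrite -(mulVKg x y) wE.
by apply: (conn #|T|) => t _; exact: leq_addl.
Qed.

(** * Holonomy of edge labellings *)

Section Holonomy.
Variables (F : groupType) (L : T -> G -> F).
Hypothesis L_mul : forall s h x, h \in H -> L s (h * x) = L s x.

Definition step s x : F := if marked s x then L s x else (L s (x * S s))^-1.

Lemma step_mul s h x : h \in H -> step s (h * x) = step s x.
Proof. by move=> hH; rewrite /step (marked_mul _ _ hH) -mulgA !(L_mul _ _ hH). Qed.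

Lemma stepV s x : edge s x -> step s (x * S s) = (step s x)^-1.
Proof.
rewrite /edge /step genKr; have [mx _|mx /= ->] := boolP (marked s x).
  case: ifP => // mxs; have := marked_uniq (related_gen s x) mx mxs.
  move=> /(congr1 (fun y => x^-1 * y)); rewrite mulVg mulKg => s1.
  by have := gen_neq1 S s; rewrite -s1 eqxx.
by rewrite invgK.
Qed.

Fixpoint hol x w : F := if w is s :: w' then step s x * hol (x * S s) w' else 1.

Lemma hol_mul h x w : h \in H -> hol (h * x) w = hol x w.
Proof. by move=> hH; elim: w x => //= s w IH x; rewrite (step_mul _ _ hH) -mulgA IH. Qed.

Lemma hol_cat x w1 w2 : hol x (w1 ++ w2) = hol x w1 * hol (x * ev w1) w2.
Proof.
elim: w1 x => [|s w1 IH] x /=; first by rewrite ev_nil mulg1 mul1g.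
by rewrite IH ev_cons !mulgA.
Qed.

Lemma hol_rev x w : treepath x w -> hol (x * ev w) (rev w) = (hol x w)^-1.
Proof.
elim: w x => [|s w IH] x /=; first by rewrite invg1.
move=> /andP[ex xw]; rewrite rev_cons -cats1 hol_cat ev_cons !(mulgA x) IH //=.
by rewrite ev_rev mulgK stepV // mulg1 invgM.
Qed.

(* A closed path crosses the wall of its first letter of least rank again; the
   two edges are related, hence equal, and the excursion between them is
   closed. *)
Lemma hol_closed x w : treepath x w -> ev w = 1 -> hol x w = 1.
Proof.
have [n] := ubnP (size w); elim: n x w => // n IH x [|s0 w0] // /ltnSE wn xw w1.
set w := s0 :: w0 in wn xw w1 *.
have [s sw smin] : exists2 s, s \in w & {in w, forall t, (rank s <= rank t)%N}.
  have : exists k, has (fun s => rank s == k) w.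
    by exists (rank s0); rewrite /= eqxx.
  case/ex_minnP => k /hasP[s sw /eqP sk] kmin; exists s => // t tw.
  by rewrite sk; apply: kmin; apply/hasP; exists t.
have [a [b [wE sa]]] : exists a b, w = a ++ s :: b /\ s \notin a.
  elim: (w) sw => // t v IHv; rewrite inE; have [->|/= st /IHv[a [b [-> sa]]]] := eqVneq s t.
    by exists [::], v.
  by exists (t :: a), b; rewrite inE negb_or st.
have cross0 v : s \notin v -> forall r, parity S s r -> crosses S r (ev v) = false.
  move=> sv r sr; rewrite crosses_ev (count_memPn _) //; apply: contra sv => /wallsP[v1 [t [v2 [-> rE]]]].
  by move: sr; rewrite rE parity_refl mem_cat inE => /eqP->; rewrite eqxx orbT.
have sb : crosses S (S s) (ev b).
  have := crosses1 S (S s ^ (ev a)^-1); rewrite -w1 wE ev_cat ev_cons !crosses_mul.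
  by rewrite (cross0 a) ?parity_refl // conjgKV crosses_gen eqxx conjgE mulKg; case: crosses.
have [b1 [t [b2 [bE tE sb1]]]] := crosses_split sb.
have ts : t = s by apply/eqP; rewrite -(parity_refl S s t (ev b1)^-1) -tE parity_gen.
subst t; have nsb1 : crosses S (S s) (ev b1) = false by rewrite crosses_ev (count_memPn _).
have [v [vred vE vb1]] := reduced_sub S b1.
have sv := @adjacent_of_commute _ _ e_sym e_irr _ S s v vred.
rewrite vE nsb1 in sv.
have {}sv : {in v, forall t, e s t}.
  by apply: sv => //; rewrite {1}tE conjgE invgK !mulgA mulgVK.
pose xa := x * ev a; pose y := xa * S s; pose y' := y * ev b1.
have yy' : related s y y'.
  exists v; rewrite vE; split=> // t tv; rewrite inE /= (sv t tv) /=.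
  rewrite ltn_neqAle smin ?andbT; last by rewrite wE bE mem_cat inE mem_cat (vb1 _ tv) !orbT.
  by case: eqVneq => //= ts; rewrite (inj_eq val_inj) (inj_eq enum_rank_inj) eq_sym.
move: xw; rewrite wE bE treepath_cat /= treepath_cat /=.
rewrite -/xa -/y -/y' => /andP[pa /andP[exa /andP[pb1 /andP[ey' pb2]]]].
(* The two edges are related and each is marked in some orientation, so they coincide. They could
   only coincide reversed if [ev b1] were [S s], but [b1] does not cross that wall. *)
have b11 : ev b1 = 1.
  have yxa : related s y xa by rewrite -[xa](genKr S s); exact: related_gen.
  have y'y' := related_gen s y'.
  have bad : ev b1 <> S s by move=> b1s; move: nsb1; rewrite b1s crosses_gen eqxx.
  case/orP: exa => mxa; case/orP: ey' => my'.
  - have E := marked_uniq (related_trans (related_sym yxa) yy') mxa my'.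
    case: bad; apply: (mulgI y); rewrite -/y' -E /y genKr //.
  - have E := marked_uniq (related_trans (related_sym yxa) (related_trans yy' y'y')) mxa my'.
    by apply: (mulgI y); apply: (mulIg (S s)); rewrite -/y' -E mulg1 /y genKr.
  - have E := marked_uniq yy' mxa my'.
    by apply: (mulgI y); rewrite -/y' -E mulg1.
  have E := marked_uniq (related_trans yy' y'y') mxa my'.
  by case: bad; apply: (mulgI y); apply: (mulIg (S s)); rewrite -/y' -E genKr.
have y'y : y' = y by rewrite /y' b11 mulg1.
have yxa : y * S s = xa by rewrite /y genKr.
have sy : step s y = (step s xa)^-1 by rewrite stepV.
rewrite y'y yxa in pb2; have sizes : (size b1 < n)%N /\ (size (a ++ b2) < n)%N.
  by rewrite wE bE in wn; move: wn; rewrite !size_cat /= size_cat /=; lia.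
rewrite hol_cat /= hol_cat /= -/xa -/y -/y' y'y yxa sy (IH y b1) ?sizes.1 //.
rewrite mul1g mulVKg -hol_cat; apply: IH; rewrite ?sizes.2 ?treepath_cat ?pa //.
by rewrite -w1 wE bE !ev_cat !ev_cons ev_cat ev_cons b11 mul1g genK.
Qed.

Lemma hol_indep x w1 w2 : treepath x w1 -> treepath x w2 -> ev w1 = ev w2 ->
  hol x w1 = hol x w2.
Proof.
move=> xw1 xw2 w12; have := @hol_closed x (w1 ++ rev w2).
rewrite treepath_cat hol_cat ev_cat xw1 ev_rev w12 hol_rev // treepath_rev // mulgV.
by move=> /(_ isT erefl)/divg1_eq.
Qed.

Definition rho x : F := hol 1 (s2val (cid2 (tree_connected 1 x))).

Lemma rho_path x w : treepath x w -> rho (x * ev w) = rho x * hol x w.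
Proof.
rewrite /rho; case: cid2 => /= u pu uE; case: cid2 => /= v pv vE xw.
rewrite mul1g in uE; rewrite mul1g in vE.
have -> : hol x w = hol (1 * ev v) w by rewrite mul1g -vE.
rewrite -hol_cat; apply: hol_indep => //; last by rewrite -uE ev_cat -vE.
by rewrite treepath_cat pv mul1g -vE.
Qed.

Lemma rho1 : rho 1 = 1.
Proof.
by rewrite /rho; case: cid2 => /= w pw wE; apply: hol_closed; rewrite // wE mul1g.
Qed.

(** The tree path from 1 to [x], translated by [h], leads from [h] to [h * x] with the same
    holonomy. *)
Lemma rho_mul h x : h \in H -> rho (h * x) = rho h * rho x.
Proof.
move=> hH; have [w pw xE] := tree_connected 1 x; rewrite mul1g in xE.
have := @rho_path 1 w pw; rewrite rho1 !mul1g -xE => ->.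
rewrite xE rho_path; first by have := hol_mul 1 w hH; rewrite mulg1 => ->.
by have := treepath_mul 1 w hH; rewrite mulg1 => ->.
Qed.

End Holonomy.

(** * Retraction onto the subgroup along the tree *)

Lemma height_ex x : exists n, `[< exists w, [/\ size w = n, treepath x w & x * ev w \in H] >].
Proof.
have [w xw wE] := tree_connected x 1; exists (size w); apply/asboolP; exists w.
by rewrite -wE gpred1.
Qed.

Definition height x : nat := ex_minn (height_ex x).

Lemma height_mul h x : h \in H -> height (h * x) = height x.
Proof.
move=> hH; apply: eq_ex_minn => n; apply/asbool_equiv_eq.
have inH w : (h * x * ev w \in H) = (x * ev w \in H) by rewrite -mulgA (gpredMl _ hH).
by split=> -[w [sw pw wH]]; exists w; move: pw wH; rewrite (treepath_mul _ _ hH) inH; split.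
Qed.

Lemma height_le x w : treepath x w -> x * ev w \in H -> (height x <= size w)%N.
Proof.
by move=> xw wH; rewrite /height; case: ex_minnP => n _; apply; apply/asboolP; exists w.
Qed.

Definition descent x : option T :=
  [pick s | edge s x && (height (x * S s) < height x)%N].

Lemma descent_mul h x : h \in H -> descent (h * x) = descent x.
Proof.
move=> hH; apply: eq_pick => s.
by rewrite (edge_mul _ _ hH) -mulgA !(height_mul _ hH).
Qed.

Lemma descentP x : x \notin H -> exists s,
  [/\ descent x = Some s, edge s x & (height (x * S s) < height x)%N].
Proof.
move=> xH; rewrite /descent; case: pickP => [s /andP[]|no]; first by exists s.
have : `[< exists w, [/\ size w = height x, treepath x w & x * ev w \in H] >].
  by rewrite /height; case: ex_minnP.
move=> /asboolP[[|s w] [sw /= pw wH]]; first by move: xH; rewrite -(mulg1 x) -(ev_nil S) wH.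
case/andP: pw => es pw; have := no s; rewrite es /= -sw ltnS height_le //.
by rewrite -mulgA -ev_cons.
Qed.

Lemma descent_in x : x \in H -> descent x = None.
Proof.
move=> xH; rewrite /descent; case: pickP => // s /andP[_].
have := @height_le x [::] isT; rewrite ev_nil mulg1 => /(_ xH) /=; rewrite leqn0 => /eqP->.
by rewrite ltn0.
Qed.

Fixpoint retract_fuel n x : G :=
  if n is n'.+1 then if descent x is Some s then retract_fuel n' (x * S s) else x else x.

(** Every descent lowers [height], so [height x] is enough fuel to arrive in [H]. The fibre over 1
    serves as the fundamental subtree. *)
Definition retract x : G := retract_fuel (height x) x.

Lemma height_eq0 x : (height x == 0%N) = (x \in H).
Proof.
apply/idP/idP => [|xH]; last by rewrite -leqn0 -[0%N]/(size (Nil T)) height_le // ev_nil mulg1.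
rewrite /height; case: ex_minnP => n /asboolP[w [sw _ wH]] _ /eqP n0.
by move: sw wH; rewrite n0 => /size0nil ->; rewrite ev_nil mulg1.
Qed.

Lemma retract_fuelE n x : (height x <= n)%N -> retract_fuel n x = retract x.
Proof.
rewrite /retract; have [m] := ubnP (height x).
elim: m n x => // m IH n x /ltnSE xm xn.
have [xH|xH] := boolP (x \in H).
  have : height x = 0%N by apply/eqP; rewrite height_eq0.
  by move=> ->; case: n xn => //= n _; rewrite descent_in.
have [s [sE es lt]] := descentP xH.
case: n xn => [|n] xn; first by move: xn; rewrite leqn0 height_eq0 (negPf xH).
rewrite /= sE; case hx : (height x) lt xm xn => [|k] // lt km kn; rewrite /= sE.
by rewrite IH ?[RHS]IH //; lia.
Qed.

Lemma retract_in x : x \in H -> retract x = x.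
Proof. by move=> xH; rewrite /retract; case: height => //= n; rewrite descent_in. Qed.

Lemma retract_step x s : descent x = Some s -> x \notin H -> retract (x * S s) = retract x.
Proof.
move=> sE xH; have [t [tE _ lt]] := descentP xH.
move: tE lt; rewrite sE => -[<-]; rewrite {2}/retract.
by case: (height x) => // k lt; rewrite /= sE retract_fuelE.
Qed.

Lemma retract_mul h x : h \in H -> retract (h * x) = h * retract x.
Proof.
move=> hH; rewrite /retract height_mul //; move: (height x) => n; elim: n x => //= n IH x.
by rewrite descent_mul //; case: descent => // s; rewrite -mulgA IH.
Qed.

Lemma retract_ind (P : G -> Prop) : (forall x, x \in H -> P x) ->
  (forall x s, edge s x -> retract (x * S s) = retract x -> P (x * S s) -> P x) ->
  forall x, P x.
Proof.
move=> PH PS x; have [n] := ubnP (height x); elim: n x => // n IH x /ltnSE xn.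
have [/PH//|xH] := boolP (x \in H); have [s [sE es lt]] := descentP xH.
by apply: (PS x s) => //; [exact: retract_step|apply: IH; exact: leq_trans lt xn].
Qed.

Lemma retractP x : retract x \in H.
Proof. by elim/retract_ind: x => [x xH|x s _ <- //]; rewrite retract_in. Qed.

End Tree.

Section WordEvaluation.
Variables (T : choiceType) (rels : set (gword T * gword T)) (G : groupType) (f : T -> G).

Definition letter_eval (l : bool * T) : G := if l.1 then (f l.2)^-1 else f l.2.
Definition word_eval (u : gword T) : G := \prod_(l <- u) letter_eval l.

Lemma word_eval_cat u v : word_eval (u ++ v) = word_eval u * word_eval v.
Proof. by rewrite /word_eval big_cat. Qed.

Lemma word_eval_eq : (forall r, rels r -> word_eval r.1 = word_eval r.2) ->
  forall u v, word_eq rels u v -> word_eval u = word_eval v.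
Proof.
move=> fr u v; elim=> {u v} [//|u v _ -> //|u v w _ -> _ -> //|u v l|u v r rr]; last first.
  by rewrite !word_eval_cat fr.
rewrite !word_eval_cat; congr (_ * _); rewrite -[RHS]mul1g; congr (_ * _).
rewrite /word_eval !big_cons big_nil mulg1 /letter_eval /inv_letter.
by case: l => -[] x /=; rewrite ?mulVg ?mulgV.
Qed.

End WordEvaluation.

(** * Freeness *)

Section Freeness.
Variables (T : finType) (e : rel T).
Hypotheses (e_sym : symmetric e) (e_irr : irreflexive e).
Variables (G : groupType) (S : coxeter_presentation e G) (H : groupClosed G).
Hypothesis H_cent : forall h g, h \in H -> h != 1 -> g * h = h * g -> g \in H.
Hypothesis H_refl : forall s g, S s ^ g \notin H.

Local Notation retract := (retract e_sym S H).
Local Notation marked := (marked S H).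

(* The marked edges leaving the fundamental tree [retract x = 1], one for each
   pair of adjacent translates of it. *)
Definition leaving (p : G * T) : bool :=
  [&& retract p.1 == 1, marked p.2 p.1 & retract (p.1 * S p.2) != 1].

Definition basis : choiceType := {p : G * T | leaving p}.

Definition basis_elt (i : basis) : G := retract ((val i).1 * S (val i).2).

Definition free_gen (i : basis) : free_group basis := pclass set0 [:: (false, i)].

(** A marked edge is translated so that it starts in the fundamental tree; it contributes a
    generator if it then leaves that tree and 1 if it stays inside. *)
Definition label (s : T) (x : G) : free_group basis :=
  if insub ((retract x)^-1 * x, s) is Some i then free_gen i else 1.

Lemma label_mul s h x : h \in H -> label s (h * x) = label s x.
Proof. by move=> hH; rewrite /label retract_mul // invgM -mulgA mulKg. Qed.

Lemma label_inner s x : retract (x * S s) = retract x -> label s x = 1.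
Proof.
move=> xs; rewrite /label; case: insubP => // i /and3P[_ _ /eqP ne] _; case: ne.
by rewrite /= -mulgA retract_mul ?gpredV ?retractP // xs mulVg.
Qed.

Definition eval_free (u : free_group basis) : G := word_eval basis_elt (prepr u).

Lemma eval_pclass (u : gword basis) : eval_free (pclass set0 u) = word_eval basis_elt u.
Proof. by apply: (@word_eval_eq _ set0) => //; exact: prepr_pclass. Qed.

Lemma eval_freeM : {morph eval_free : u v / u * v}.
Proof.
move=> u v; rewrite -[u]preprK -[v]preprK.
by rewrite [X in eval_free X]pmulE !eval_pclass word_eval_cat.
Qed.

Lemma eval_gen i : eval_free (free_gen i) = basis_elt i.
Proof. by rewrite eval_pclass /word_eval big_seq1. Qed.

Lemma eval_free1 : eval_free 1 = 1.
Proof. by have := eval_pclass [::]; rewrite /word_eval big_nil. Qed.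

Lemma eval_freeV u : eval_free u^-1 = (eval_free u)^-1.
Proof. by apply: (mulgI (eval_free u)); rewrite -eval_freeM !mulgV eval_free1. Qed.

Lemma eval_label s x : marked s x -> eval_free (label s x) = (retract x)^-1 * retract (x * S s).
Proof.
move=> sx; have xH : (retract x)^-1 \in H by rewrite gpredV retractP.
rewrite /label; case: insubP => [i _ iE|]; first by rewrite eval_gen /basis_elt iE /= -mulgA (retract_mul e_sym S _ xH).
rewrite /leaving /= -mulgA !(retract_mul e_sym S _ xH) mulVg eqxx (marked_mul S _ _ xH) sx /=.
by rewrite negbK => /eqP ->; exact: eval_free1.
Qed.

Local Notation hol := (hol S H label).
Local Notation rho := (rho e_sym S H label).

(** Telescoping: each step evaluates to the change of [retract] along its edge. *)
Lemma eval_hol x w : treepath S H x w ->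
  eval_free (hol x w) = (retract x)^-1 * retract (x * ev S w).
Proof.
elim: w x => [|s w IH] x /=; first by rewrite eval_free1 ev_nil mulg1 mulVg.
move=> /andP[xs xw]; rewrite eval_freeM IH // ev_cons mulgA; gsimp.
suff -> : eval_free (step S H label s x) = (retract x)^-1 * retract (x * S s) by gsimp.
rewrite /step; case: ifP => [/eval_label//|sx]; move: xs; rewrite /edge sx /= => sx'.
by rewrite eval_freeV eval_label // genKr invgM invgK.
Qed.

Lemma eval_rho h : h \in H -> eval_free (rho h) = h.
Proof.
move=> hH; have [w pw hE] := tree_connected e_sym S H 1 h.
rewrite {1}hE rho_path // rho1 // mul1g eval_hol // -hE !retract_in ?gpred1 //.
by rewrite invg1 mul1g.
Qed.

(** The descent from [x] to [retract x] stays in one fibre of [retract], where the labels are 1. *)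
Lemma rho_retract x : rho (retract x) = rho x.
Proof.
elim/(@retract_ind _ _ e_sym _ S H): x => [x xH|x s xs xsE IH]; first by rewrite retract_in.
rewrite -xsE IH; have := @rho_path _ _ e_sym e_irr _ S H H_cent H_refl _ label x [:: s].
rewrite ev1 /= xs mulg1 => -> //; rewrite /step; case: ifP => _.
  by rewrite label_inner ?mulg1.
by rewrite label_inner ?invg1 ?mulg1 // genKr.
Qed.

Lemma rho_basis i : rho (basis_elt i) = free_gen i.
Proof.
have /and3P[/eqP i1 im i2] := valP i; rewrite /basis_elt rho_retract.
have := @rho_path _ _ e_sym e_irr _ S H H_cent H_refl _ label (val i).1 [:: (val i).2].
rewrite ev1 /= /edge im => -> //.
rewrite -rho_retract i1 rho1 // /step im mul1g mulg1 /label i1 invg1 mul1g.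
by rewrite -surjective_pairing valK.
Qed.

Lemma letter_eval_in l : letter_eval basis_elt l \in H.
Proof. by case: l => -[] i; rewrite /letter_eval /= ?gpredV retractP. Qed.

Lemma rho_eval u : rho (eval_free u) = u.
Proof.
rewrite -[u]preprK eval_pclass; elim: (prepr u) => [|l w IH].
  by rewrite /word_eval big_nil rho1.
rewrite /word_eval big_cons rho_mul //; [|exact: label_mul|exact: letter_eval_in].
rewrite -/(word_eval _ w) IH -cat1s.
have -> : pclass set0 ([:: l] ++ w) = pclass set0 [:: l] * pclass set0 w :> free_group basis.
  by rewrite [RHS]pmulE.
congr (_ * _); case: l => -[] i; rewrite /letter_eval /= ?rho_basis //.
have rM := rho_mul e_sym e_irr H_cent H_refl label_mul.
apply: (mulgI (rho (basis_elt i))); rewrite -rM ?retractP // mulgV rho1 //.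
rewrite rho_basis; apply/esym; rewrite [LHS]pmulE; apply/pclassP.
exact: (word_eq_cancel set0 [::] [::] (false, i)).
Qed.

(** [eval_free] and the restriction of [rho] to [H] are mutually inverse. *)
Lemma malnormal_free : is_free H.
Proof.
exists basis, eval_free; split; first exact: eval_freeM.
  exact: can_inj rho_eval.
apply/seteqP; split=> [_ [u _ <-]|h hH] /=; last by exists (rho h); rewrite ?eval_rho.
rewrite /eval_free /word_eval; elim: (prepr u) => [|l w IH]; first by rewrite big_nil gpred1.
by rewrite big_cons gpredM ?letter_eval_in.
Qed.

End Freeness.

(** * The defining presentation and its universal property *)

Section RacgPresentation.
Variables (T : finType) (e : rel T).

Definition racg_gen (s : T) : racg e := pclass (racg_rels e) [:: (false, s)].

Lemma racg_pclass_cat u v :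
  pclass (racg_rels e) (u ++ v) = pclass _ u * pclass _ v :> racg e.
Proof. by rewrite [RHS]pmulE. Qed.

Lemma racg_gen_sqr s : racg_gen s * racg_gen s = 1.
Proof.
rewrite -racg_pclass_cat; apply/pclassP.
by apply: (word_eq_rel [::] [::] (r := ([:: (false, s); (false, s)], [::]))); left; exists s.
Qed.

Lemma racg_gen_comm s t : e s t -> racg_gen s * racg_gen t = racg_gen t * racg_gen s.
Proof.
move=> est; rewrite -!racg_pclass_cat; apply/pclassP.
by apply: (word_eq_rel [::] [::]
  (r := ([:: (false, s); (false, t)], [:: (false, t); (false, s)]))); right; exists s, t.
Qed.

Lemma racg_words (g : racg e) : exists w : seq T, g = \prod_(s <- w) racg_gen s.
Proof.
exists (map snd (prepr g)); rewrite big_map -[LHS]preprK.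
elim: (prepr g) => [|[b s] u IH]; first by rewrite big_nil.
rewrite big_cons -IH -cat1s racg_pclass_cat; congr (_ * _); case: b => //=.
apply: (mulgI (racg_gen s)); rewrite racg_gen_sqr -racg_pclass_cat; apply/pclassP.
exact: (word_eq_cancel _ [::] [::] (false, s)).
Qed.

Lemma racg_lift (X : Type) (f : T -> X -> X) :
  (forall s x, f s (f s x) = x) ->
  (forall s t x, e s t -> f s (f t x) = f t (f s x)) ->
  exists F : racg e -> X -> X, [/\ forall x, F 1 x = x,
    forall g h x, F (g * h) x = F g (F h x) & forall s x, F (racg_gen s) x = f s x].
Proof.
move=> f2 fC; pose act (u : gword T) x := foldr (fun l => f l.2) x u.
have act_cat u v x : act (u ++ v) x = act u (act v x) by rewrite /act foldr_cat.
have act_eq u v : word_eq (racg_rels e) u v -> forall x, act u x = act v x.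
  elim=> {u v} [//|u v _ uv x|u v w _ uv _ vw x|u v l x|u v r rr x].
  - by rewrite uv.
  - by rewrite uv.
  - by rewrite !act_cat /= f2.
  by rewrite !act_cat; case: rr => [[s ->]|[s [t [est ->]]]] /=; rewrite ?f2 // fC.
have actP u x : act (prepr (pclass (racg_rels e) u)) x = act u x.
  exact/act_eq/prepr_pclass.
exists (fun g => act (prepr g)); split=> [x|g h x|s x]; first exact: actP.
  by rewrite -act_cat -{1}[g]preprK -{1}[h]preprK -racg_pclass_cat actP.
exact: actP.
Qed.

Definition racg_presentation : coxeter_presentation e (racg e) :=
  Build_coxeter_presentation racg_gen_sqr racg_gen_comm racg_words racg_lift.

End RacgPresentation.

(** An [h] commuting with [g] lies in the intersection of [H] with its conjugate by [g]. *)
Lemma malnormal_cent (G : groupType) (H : groupClosed G) : malnormal H ->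
  forall h g, h \in H -> h != 1 -> g * h = h * g -> g \in H.
Proof.
move=> mal h g hH h1 gh; apply: contraT => /mal Hg.
have : ([set g * h * g^-1 | h in [set` H]] `&` [set` H])%classic h.
  by split=> //; exists h; rewrite // gh mulgK.
by rewrite Hg => /= /eqP; rewrite (negPf h1).
Qed.

(* An element of a malnormal subgroup drags its centralizer into it, so one
   reflection in H brings in, by connectedness, conjugates of all generators. *)
Lemma malnormal_refl (T : finType) (e : rel T) (H : groupClosed (racg e)) :
  (forall x y : T, connect e x y) -> malnormal H ->
  [set` H]%classic <> [set: racg e]%classic ->
  forall s g, racg_presentation e s ^ g \notin H.
Proof.
move=> conn mal proper s g; apply/negP => sH; apply: proper.
set S := racg_presentation e in sH.
have tH t : S t ^ g \in H.
  have /connectP[p] := conn s t; elim: p s sH => [|u p IH] s sH /=; first by move=> _ ->.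
  move=> /andP[esu pu] tE; apply: (IH u) => //; apply: (malnormal_cent mal sH).
    by rewrite conjg_eq1 gen_neq1.
  by rewrite -!conjMg (gen_comm S esu).
have evH w : ev S w ^ g \in H.
  elim: w => [|t w IH]; first by rewrite ev_nil conj1g gpred1.
  by rewrite ev_cons conjMg gpredM.
apply/seteqP; split=> // x _ /=; have [w xE] := gen_words S (x ^ g^-1).
by rewrite -(conjgKV g x) xE; exact: evH.
Qed.

(** * Word length and geodesics of the subgroup *)

Section WordLength.
Variables (G : groupType) (B : set G).
Local Notation hw := (has_word_of_length B).

Lemma has_word1 : hw 1 0.
Proof. by exists [::]; rewrite big_nil; split. Qed.

Lemma has_wordM g h m n : hw g m -> hw h n -> hw (g * h) (m + n).
Proof.
move=> [u [su uB ug]] [v [sv vB vh]]; exists (u ++ v); split.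
- by rewrite size_cat su sv.
- by move=> x; rewrite mem_cat => /orP[/uB|/vB].
by rewrite big_cat ug vh.
Qed.

Lemma has_wordV g n : hw g n -> hw g^-1 n.
Proof.
move=> [u [<- uB <-]] {g n}; elim: u uB => [|x u IH] uB.
  by rewrite big_nil invg1; exact: has_word1.
rewrite big_cons invgM /= -addn1; apply: has_wordM.
  by apply: IH => y yu; apply: uB; rewrite inE yu orbT.
exists [:: x^-1]; rewrite big_seq1; split=> // y; rewrite inE => /eqP->.
by rewrite invgK; have := uB x; rewrite inE eqxx => /(_ isT)[]; [right|left].
Qed.

Lemma word_lengthP g n : hw g n ->
  hw g (word_length B g) /\ (word_length B g <= n)%N.
Proof.
move=> gn; have ex : exists n, `[< hw g n >] by exists n; apply/asboolP.
rewrite /word_length; case: xgetP => [m _ [gm mmin]|no]; first by split=> //; exact: mmin.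
case: (ex_minnP ex) => m /asboolP gm mmin; case: (no m); split=> // l gl.
by apply: mmin; apply/asboolP.
Qed.

Lemma word_length1 : word_length B 1 = 0%N.
Proof. by apply/eqP; rewrite -leqn0; have [] := word_lengthP has_word1. Qed.

Definition spanned g : Prop := exists n, hw g n.

Lemma word_lengthM g h : spanned g -> spanned h ->
  (word_length B (g * h) <= word_length B g + word_length B h)%N.
Proof.
move=> [m /word_lengthP[gm _]] [n /word_lengthP[hn _]].
by have [] := word_lengthP (has_wordM gm hn).
Qed.

Lemma word_lengthV g : spanned g -> (word_length B g^-1 <= word_length B g)%N.
Proof. by move=> [m /word_lengthP[gm _]]; have [] := word_lengthP (has_wordV gm). Qed.

Lemma has_word_gen x : B x \/ B x^-1 -> hw x 1.
Proof.
move=> Bx; exists [:: x]; rewrite big_seq1; split=> // y.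
by rewrite inE => /eqP->.
Qed.

(** Follow the prefixes of a shortest word; a shorter word for a segment would shorten the whole. *)
Lemma geodesic_ex (H : groupClosed G) (bs : seq G) g h : generates B [set` H]%classic ->
  (forall x, B x \/ B x^-1 -> x \in bs) -> g \in H -> h \in H ->
  exists p, [/\ geo H bs (word_length B) p (word_dist B g h), p 0%N = g
    & p (word_dist B g h) = h].
Proof.
move=> genB bsB gH hH; rewrite /word_dist; set k := g^-1 * h; set n := word_length B k.
have inH x : (x \in H) <-> spanned x.
  by rewrite -[is_true (x \in H)]/([set` H]%classic x) genB.
have /inH[n0 /word_lengthP[[w [sw wB wk]] _]] : k \in H by rewrite gpredM // gpredV.
rewrite -/n in sw; exists (fun i => g * \prod_(x <- take i w) x).
have hwsub (v : seq G) : {subset v <= w} -> hw (\prod_(x <- v) x) (size v).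
  by move=> vw; exists v; split=> // x /vw/wB.
have step i j : (i <= j)%N ->
    \prod_(x <- take j w) x = \prod_(x <- take i w) x * \prod_(x <- take (j - i) (drop i w)) x.
  by move=> ij; rewrite -big_cat -{1}(subnKC ij) takeD.
split; [split=> [i i_n|i i_n|i j ij jn]| |].
- rewrite gpredM //; apply/inH; exists (size (take i w)); apply: hwsub => x; exact: mem_take.
- rewrite (step i i.+1) // invgM -!mulgA mulKg mulKg subSnn -sw in i_n *.
  case: (drop i w) (fun x => @mem_drop i _ w x) (size_drop i w) => [|x v] wv.
    by move/esym/eqP; rewrite subn_eq0 leqNgt i_n.
  by move=> _; rewrite /= take0 big_seq1; apply/bsB/wB/wv; rewrite inE eqxx.
- rewrite (step i j) // invgM -!mulgA mulKg mulKg; set v := take _ _.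
  have vw : {subset v <= w} by move=> x /mem_take/mem_drop.
  have [hv _] := word_lengthP (hwsub v vw).
  have hi := hwsub (take i w) (fun x => @mem_take _ _ _ x).
  have hj := hwsub (drop j w) (fun x => @mem_drop _ _ _ x).
  have [_] := word_lengthP (has_wordM (has_wordM hi hv) hj).
  rewrite -step // -big_cat cat_take_drop wk -/n size_drop sw size_takel ?sw; last by lia.
  by lia.
- by rewrite take0 big_nil mulg1.
by rewrite -sw take_size wk mulVKg.
Qed.

End WordLength.

Lemma finite_symmetric_seq (G : groupType) (B : set G) : finite_set B ->
  exists bs : seq G, forall x, x \in bs <-> B x \/ B x^-1.
Proof.
move=> /finite_seqP[s ->]; exists (s ++ [seq x^-1 | x <- s]) => x; rewrite mem_cat; split.
  by case/orP => [|/mapP[y ys ->]]; [left|right; rewrite /= invgK].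
by case=> /= [->//|xs]; apply/orP; right; apply/mapP; exists x^-1; rewrite ?invgK.
Qed.

Local Close Scope group_scope.

(** * Quasi-geodesics in the geometric Cayley graph *)

Section CayleyDistance.
Variables (R : realType) (G : groupType) (A : set G).
Hypothesis A_gen : generates A setT.
Implicit Types (x y z : G) (p q : cayley_point R A).

Lemma gen_spanned x : spanned A x.
Proof. by have : [set: G]%classic x by []; rewrite A_gen. Qed.

Lemma word_dist_tri y x z : (word_dist A x z <= word_dist A x y + word_dist A y z)%N.
Proof.
rewrite /word_dist (_ : x^-1 * z = (x^-1 * y) * (y^-1 * z))%g.
  by apply: word_lengthM; exact: gen_spanned.
by rewrite mulgA mulgK.
Qed.

Lemma word_distC x y : word_dist A x y = word_dist A y x.
Proof.
have le u v : (word_dist A u v <= word_dist A v u)%N.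
  rewrite /word_dist -[(u^-1 * v)%g]invgK invgM invgK.
  exact: word_lengthV (gen_spanned _).
by apply/eqP; rewrite eqn_leq !le.
Qed.

Lemma word_distxx x : word_dist A x x = 0%N.
Proof. by rewrite /word_dist mulVg word_length1. Qed.

Lemma word_dist_edge p : (word_dist A (src p) (dst p) <= 1)%N.
Proof.
case: p => x y t /= [->|Axy] _; first by rewrite word_distxx.
have hw1 : has_word_of_length A (x^-1 * y)%g 1 by apply: has_word_gen; rewrite invgM invgK.
by have [] := word_lengthP hw1.
Qed.

Local Open Scope ring_scope.
Local Notation D x y := ((word_dist A x y)%:R : R).
Local Notation cdist := (@cayley_dist R G A).

Lemma natr_tri y x z : D x z <= D x y + D y z.
Proof. by rewrite -natrD ler_nat word_dist_tri. Qed.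

Lemma to_src_bounds p : 0 <= to_src p <= 1.
Proof.
case: p => x y t Axy t01; rewrite /to_src /edge_length /=; move: t01.
by case: (_ != _); rewrite ?mulr1 ?mulr0 ?lexx ?ler01.
Qed.

Lemma to_dst_bounds p : 0 <= to_dst p <= 1.
Proof.
case: p => x y t Axy t01; rewrite /to_dst /edge_length /=; move: t01.
by case: (_ != _); rewrite ?mulr1 ?mulr0 ?lexx ?ler01 // => /andP[? ?]; lra.
Qed.

Lemma cayley_dist_src p q : `|cdist p q - D (src p) (src q)| <= 2.
Proof.
have dp : D (src p) (dst p) <= 1 by rewrite -[1]/(1%:R) ler_nat word_dist_edge.
have dq : D (src q) (dst q) <= 1 by rewrite -[1]/(1%:R) ler_nat word_dist_edge.
have /andP[p0 p1] := to_src_bounds p; have /andP[p0' p1'] := to_dst_bounds p.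
have /andP[q0 q1] := to_src_bounds q; have /andP[q0' q1'] := to_dst_bounds q.
have D0 x y : 0 <= D x y by exact: ler0n.
rewrite /cayley_dist; case: ifP => [/andP[/eqP -> _]|_].
  rewrite word_distxx subr0 normr_id ler_norml; lra.
case: ifP => [/andP[/eqP pq _]|_].
  rewrite pq word_distC; have := D0 (src q) (dst q); rewrite ler_norml.
  have : `|to_src p - to_dst q| <= 1 by rewrite ler_norml; lra.
  have : 0 <= `|to_src p - to_dst q| by exact: normr_ge0.
  lra.
have t1 := natr_tri (dst q) (src p) (src q); rewrite (word_distC (dst q)) in t1.
have t2 := natr_tri (dst p) (src p) (src q).
have t3 := natr_tri (dst q) (dst p) (src q); rewrite (word_distC (dst q)) in t3.
set m := Num.min _ _.
have m_le : m <= to_src p + D (src p) (src q) + to_src q by rewrite /m !ge_min lexx.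
have m_ge : D (src p) (src q) - 2 <= m by rewrite /m !le_min; apply/andP; split; apply/andP; split; lra.
by rewrite ler_norml; lra.
Qed.

Lemma cayley_dist_le p q : cdist p q <= D (src p) (src q) + 2.
Proof. by have := cayley_dist_src p q; rewrite ler_norml; lra. Qed.

Lemma src_dist_le p q : D (src p) (src q) <= cdist p q + 2.
Proof. by have := cayley_dist_src p q; rewrite ler_norml; lra. Qed.

(** Integer steps stay inside both real and integer intervals, so one sampling serves both kinds of
    quasi-geodesic. *)
Lemma RZ_interval_shift (I : set R) a b (n : nat) : RZ_interval I -> I a -> I b ->
  a + n%:R <= b -> I (a + n%:R).
Proof.
move=> [iI|[J [iJ ->]]].
  by move=> Ia Ib ab; apply: (iI a b) => //; rewrite lerDl ler0n.
move=> [Ja [k _ ka]] [Jb _] ab; split.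
  by apply: (iJ a b) => //; rewrite lerDl ler0n.
by exists (k + n%:Z) => //; rewrite intrD ka.
Qed.

Lemma sample_quasi_geodesic (K C : R) : 1 <= K -> 0 <= C -> exists lam K' C' : nat,
  forall (I : set R) (f : R -> cayley_point R A) a b g h,
  quasi_geodesic cdist K C I f -> endpoints I a b ->
  at_vertex (f a) g -> at_vertex (f b) h ->
  exists (N : nat) (q : nat -> G), [/\ q 0%N = g, q N = h,
    forall i, (i < N)%N -> (word_dist A (q i) (q i.+1) <= lam)%N,
    forall i j, (i <= j)%N -> (j <= N)%N -> (j - i <= K' * word_dist A (q i) (q j) + C')%N
    & (forall t, I t -> exists2 i, (i <= N)%N & (word_dist A (src (f t)) (q i) <= lam)%N) /\
      (forall i, (i <= N)%N -> exists2 t, I t & (word_dist A (src (f t)) (q i) <= lam)%N)].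
Proof.
move=> K1 C0.
have [k Kk] : exists k : nat, K <= k%:R by exists (Num.bound K); apply/ltW/archi_boundP; lra.
have [c Cc] : exists c : nat, C <= c%:R by exists (Num.bound C); apply/ltW/archi_boundP.
(* Consecutive sample parameters differ by at most 3. The 6 is the cost of replacing [cayley_dist]
   by the word distance of samples: 2 for passing to sources and 2 at each of the two samples. *)
exists (k * 3 + c + 6)%N, k, (2 + k * (6 + c))%N => I f a b g h [RZI qg] [Ia Ib Iab] fa fb.
have ab : a <= b by have /andP[] := Iab a Ia; lra.
have [n /andP[n_le n_gt]] : exists n : nat, n%:R <= b - a < n.+1%:R.
  by exists (Num.truncn (b - a)); apply: truncn_itv; lra.
(* The parameters are [a, a, a + 1, ..., a + n, b]. The value [a] is repeated because the path must
   start exactly at [g], from which [src (f a)] may differ. *)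
pose sg i := if i is j.+1 then if (j <= n)%N then a + j%:R else b else a.
pose q i := if i is j.+1 then if (j <= n)%N then src (f (sg i)) else h else g.
have sgI i : I (sg i).
  case: i => //= j; case: leqP => // jn; apply: (RZ_interval_shift RZI Ia Ib).
  by move: jn; rewrite -(ler_nat R); lra.
have qsg i : D (src (f (sg i))) (q i) <= 2.
  have vtx s x : at_vertex (f s) x -> D (src (f s)) x <= 2.
    by move=> sx; have := src_dist_le (f s) (vertex R A x); rewrite sx /=; lra.
  case: i => [|j] /=; first exact: vtx.
  by case: leqP => [_|_]; [rewrite word_distxx|exact: vtx].
have sg_mono i j : (i <= j)%N -> (j <= n.+2)%N ->
    (j - i)%N%:R - 2 <= sg j - sg i <= (j - i)%N%:R + 2.
  have sgE l : (l <= n.+2)%N -> a + l%:R - 2 <= sg l <= a + l%:R.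
    case: l => [|l] /=; first by lra.
    rewrite ltnS => ln; case: leqP => [_|nl]; first by rewrite -addn1 natrD; lra.
    have -> : l = n.+1 by lia.
    by rewrite -addn1 natrD; move: n_gt; rewrite -addn1 natrD; lra.
  move=> ij jn; have := sgE _ jn; have := sgE _ (leq_trans ij jn); rewrite natrB //; lra.
have qq i j : (i <= j)%N -> (j <= n.+2)%N -> exists2 v : R, D (q i) (q j) - 6 <= v <= D (q i) (q j) + 6
   & K^-1 * `|sg i - sg j| - C <= v <= K * `|sg i - sg j| + C.
  move=> ij jn; exists (cdist (f (sg i)) (f (sg j))); last exact: qg.
  have := cayley_dist_le (f (sg i)) (f (sg j)); have := src_dist_le (f (sg i)) (f (sg j)).
  have := qsg i; have := qsg j.
  have := natr_tri (src (f (sg i))) (q i) (q j); have := natr_tri (src (f (sg j))) (src (f (sg i))) (q j).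
  have := natr_tri (q i) (src (f (sg i))) (src (f (sg j))).
  have := natr_tri (q j) (q i) (src (f (sg j))).
  rewrite (word_distC (q i) (src (f (sg i)))) (word_distC (q j) (src (f (sg j)))); lra.
have lamE : (k * 3 + c + 6)%N%:R = k%:R * 3 + c%:R + 6 :> R by rewrite !natrD natrM.
have to_lam x y : D x y <= k%:R * 3 + c%:R + 6 -> (word_dist A x y <= k * 3 + c + 6)%N.
  by rewrite -lamE ler_nat.
exists n.+2, q; split=> //.
- by rewrite /q /= ltnn.
- move=> i i_n; apply: to_lam; have [v] := qq i i.+1 (leqnSn _) i_n.
  have := sg_mono i i.+1 (leqnSn _) i_n; rewrite subSnn.
  move=> sgi vq /andP[_ vK]; have : `|sg i - sg i.+1| <= 3 by rewrite ler_norml; lra.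
  move=> s3; have : K * `|sg i - sg i.+1| <= k%:R * 3 by apply: ler_pM => //; lra.
  lra.
- move=> i j ij jn; rewrite -(ler_nat R) natrD natrM natrD natrM natrD.
  have [v vq /andP[vK _]] := qq i j ij jn; have := sg_mono i j ij jn.
  have Kp : 0 < K by lra.
  have : `|sg i - sg j| <= k%:R * (D (q i) (q j) + 6 + c%:R).
    apply: le_trans (_ : K * (D (q i) (q j) + 6 + C) <= _); last first.
      by apply: ler_pM; rewrite ?addr_ge0 ?ler0n //; lra.
    by rewrite -ler_pdivrMl //; lra.
  have := ler_norm (sg j - sg i); rewrite distrC; lra.
- split=> [t It|i i_n]; last first.
    exists (sg i); first exact: sgI.
    by apply: to_lam; apply: le_trans (qsg i) _; have := ler0n R k; have := ler0n R c; lra.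
  have /andP[at_ tb] := Iab t It.
  have [i /andP[i_le i_gt]] : exists i : nat, i%:R <= t - a < i.+1%:R.
    by exists (Num.truncn (t - a)); apply: truncn_itv; lra.
  have i_n : (i <= n)%N.
    by rewrite -ltnS -(ltr_nat R); apply: le_lt_trans i_le _; lra.
  exists i.+1; first by rewrite ltnS (leq_trans i_n).
  have sgE : sg i.+1 = a + i%:R by rewrite /sg i_n.
  have -> : q i.+1 = src (f (a + i%:R)) by rewrite /q i_n sgE.
  apply: to_lam; apply: le_trans (src_dist_le _ _) _.
  have Ii : I (a + i%:R) by rewrite -sgE.
  have /andP[_ vK] := qg t _ It Ii; move: i_gt; rewrite -addn1 natrD => i_gt.
  have s1 : `|t - (a + i%:R)| <= 1 by rewrite ler_norml; lra.
  have : K * `|t - (a + i%:R)| <= k%:R * 1 by apply: ler_pM => //; lra.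
  have := ler0n R k; lra.
Qed.

End CayleyDistance.

Section Conclusion.
Variables (R : realType) (T : finType) (e : rel T).
Hypotheses (e_sym : symmetric e) (e_irr : irreflexive e).
Variables (G : groupType) (S : coxeter_presentation e G) (H : groupClosed G).

Lemma len_le_word (A : set G) : finite_set A ->
  exists c, forall g n, has_word_of_length A g n -> (len S g <= c * n)%N.
Proof.
move=> /finite_symmetric_seq[s sA]; exists (\max_(x <- s) len S x) => g n.
move=> [w [<- wA <-]]; elim: w wA => [|x w IH] wA; first by rewrite big_nil len1.
rewrite big_cons mulnS; apply: leq_trans (lenM _ _ _) _; apply: leq_add.
  by apply: leq_bigmax_seq => //; apply/sA/wA; rewrite inE eqxx.
by apply: IH => y yw; apply: wA; rewrite inE yw orbT.
Qed.

Lemma word_le_len (A : set G) : generates A setT ->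
  exists c, forall g, (word_length A g <= c * len S g)%N.
Proof.
move=> genA; exists (\max_s word_length A (S s)) => g.
rewrite -{1}(ev_redw S g) /len; elim: (redw S g) => [|s w IH].
  by rewrite ev_nil word_length1.
rewrite ev_cons /= mulnS; apply: leq_trans (word_lengthM _ _) _; try exact: gen_spanned.
by rewrite leq_add //; exact: (leq_bigmax s).
Qed.

Hypothesis H_cent : forall h g, h \in H -> (h != 1 -> g * h = h * g -> g \in H)%g.
Hypothesis H_refl : forall s g, (S s ^ g)%g \notin H.
Hypothesis H_fg : finitely_generated [set` H]%classic.

Lemma morse_subgroup (A : set G) (K C : R) :
  finite_set A -> generates A setT -> (1 <= K)%R -> (0 <= C)%R ->
  exists M : nat, forall g h, g \in H -> h \in H -> exists Z : seq G,
    (forall z, z \in Z -> z \in H) /\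
    forall (I : set R) (f : R -> cayley_point R A) a b,
    quasi_geodesic (@cayley_dist R G A) K C I f -> endpoints I a b ->
    at_vertex (f a) g -> at_vertex (f b) h ->
    (forall t, I t -> exists2 z, z \in Z & (word_dist A (src (f t)) z <= M)%N) /\
    (forall z, z \in Z -> exists2 t, I t & (word_dist A (src (f t)) z <= M)%N).
Proof.
move=> finA genA K1 C0; have [B [finB genB]] := H_fg.
have [bs bsP] := finite_symmetric_seq finB.
have [c1 c1P] := len_le_word finA; have [c2 c2P] := word_le_len genA.
have dist_le x y : (dist S x y <= c1 * word_dist A x y)%N.
  by have [n /word_lengthP[hw _]] := gen_spanned genA (x^-1 * y)%g; exact: c1P hw.
have word_le x y : (word_dist A x y <= c2 * dist S x y)%N by exact: c2P.
have [lam [K' [C' sample]]] := sample_quasi_geodesic genA K1 C0.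
have [M MP] := discrete_morse e_sym e_irr H_cent H_refl bs (word_length1 B)
  (c1 * lam) (K' * c2) C'.
exists (lam + c2 * M)%N => g h gH hH.
have [p [gp p0 pn]] := geodesic_ex genB (fun x => (bsP x).2) gH hH.
have [Z [ZH ZP]] := MP _ _ gp; exists Z; split=> // I f a b qg ep fa fb.
have [N [q [q0 qN qlam qK [near1 near2]]]] := sample _ _ _ _ _ _ qg ep fa fb.
have [||i iN|i j ij jN|Z1 Z2] := ZP N q; rewrite ?p0 ?pn //.
- by apply: leq_trans (dist_le _ _) _; rewrite leq_mul2l qlam ?orbT.
- by apply: leq_trans (qK i j ij jN) _; rewrite leq_add2r -mulnA leq_mul2l word_le orbT.
have close x y z : (word_dist A x y <= lam)%N -> (dist S y z <= M)%N ->
    (word_dist A x z <= lam + c2 * M)%N.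
  move=> xy yz; apply: leq_trans (word_dist_tri genA y x z) _; apply: leq_add => //.
  by apply: leq_trans (word_le _ _) _; rewrite leq_mul2l yz orbT.
split=> [t /near1[i /Z1[z zZ iz] ti]|z /Z2[i /near2[t It ti] iz]].
  by exists z => //; exact: close ti iz.
by exists t => //; exact: close ti iz.
Qed.

Local Open Scope ring_scope.

Lemma subgroup_strongly_quasiconvex : strongly_quasiconvex R H.
Proof.
move=> A finA genA K C K1 C0; have [M MP] := morse_subgroup finA genA K1 C0.
exists (M%:R + 2) => I f a b g h qg ep gH hH fa fb _ [t It <-].
have [Z [ZH ZP]] := MP g h gH hH; have [near _] := ZP I f a b qg ep fa fb.
have [z zZ tz] := near t It; exists (vertex R A z); first by exists z => //=; exact: ZH.
by apply: le_trans (cayley_dist_le genA _ _) _; rewrite lerD2r ler_nat.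
Qed.

(** The bound of [B]-length by [A]-length is [linear_divergence] along a geodesic of [H]. *)
Lemma subgroup_undistorted : undistorted R H.
Proof.
move=> A B finA genA finB genB.
have [bs bsP] := finite_symmetric_seq finB.
have [c1 c1P] := len_le_word finA; have [c2 c2P] := word_le_len genA.
have [c3 c3P] := len_le_word finB.
have [L _ LP] := linear_divergence e_sym e_irr H_cent H_refl bs (word_length1 B).
exists (L * c1 + c2 * c3 + 1)%N%:R, L%:R; split; rewrite ?ler0n ?ler1n ?addn1 // => x y xH yH.
have [p [gp p0 pn]] := geodesic_ex genB (fun x => (bsP x).2) xH yH.
have lo := LP _ _ gp; rewrite p0 pn in lo.
have [n /word_lengthP[hwA _]] := gen_spanned genA (x^-1 * y)%g.
have lo' : (word_dist B x y <= L * c1 * word_dist A x y + L)%N.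
  apply: leq_trans lo _; rewrite leq_add2r -mulnA leq_mul2l.
  by apply/orP; right; exact: c1P hwA.
have [m hwm] : spanned B (x^-1 * y)%g.
  have : [set` H]%classic (x^-1 * y)%g by rewrite /= gpredM // gpredV.
  by rewrite genB.
have [hwB _] := word_lengthP hwm.
have hi : (word_dist A x y <= c2 * c3 * word_dist B x y)%N.
  by apply: leq_trans (c2P _) _; rewrite -mulnA leq_mul2l (c3P _ _ hwB) orbT.
apply/andP; split.
  rewrite lerBlDr ler_pdivrMl ?ltr0n //.
  rewrite -natrD -natrM ler_nat mulSn mulnDr; apply: leq_trans lo' _; nia.
by rewrite -natrM -natrD ler_nat; nia.
Qed.

Lemma subgroup_stable : stable R H.
Proof.
split; [exact: H_fg|exact: subgroup_undistorted|].
move=> A finA genA K L K1 L0; have [M MP] := morse_subgroup finA genA K1 L0.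
exists (M%:R + M%:R + 2); split; first by rewrite !addr_ge0.
move=> I1 I2 f1 f2 a1 b1 a2 b2 g h qg1 ep1 qg2 ep2 gH hH fa1 fa2 fb1 fb2.
have [Z [ZH ZP]] := MP g h gH hH.
have [near1 near1'] := ZP _ _ _ _ qg1 ep1 fa1 fb1.
have [near2 near2'] := ZP _ _ _ _ qg2 ep2 fa2 fb2.
have close (p q : cayley_point R A) z :
    (word_dist A (src p) z <= M)%N -> (word_dist A (src q) z <= M)%N ->
    cayley_dist p q <= M%:R + M%:R + 2.
  move=> pz qz; apply: le_trans (cayley_dist_le genA _ _) _.
  rewrite lerD2r -natrD ler_nat; apply: leq_trans (word_dist_tri genA z _ _) _.
  by rewrite leq_add // word_distC.
apply: ge_ereal_inf; exists (M%:R + M%:R + 2)%:E => //; exists (M%:R + M%:R + 2) => //; split.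
- by rewrite !addr_ge0.
- move=> _ [t It <-]; have [z zZ tz] := near1 t It; have [u Iu uz] := near2' z zZ.
  by exists (f2 u); [exists u|exact: close tz uz].
move=> _ [t It <-]; have [z zZ tz] := near2 t It; have [u Iu uz] := near1' z zZ.
by exists (f1 u); [exists u|exact: close tz uz].
Qed.

End Conclusion.

Lemma free_virtually_free (G : groupType) (H : groupClosed G) :
  is_free H -> virtually_free H.
Proof.
move=> freeH; exists H; split=> //.
apply: (sub_finite_set (B := [set [set` H]]%classic)); last exact: finite_set1.
move=> _ [h hH <-]; apply/seteqP; split=> [_ [x xH <-]|x xH] /=; first by rewrite gpredM.
by exists (h^-1 * x)%g; rewrite /= ?mulVKg // gpredM // gpredV.
Qed.

Lemma whole_strongly_quasiconvex (R : realType) (G : groupType) (H : groupClosed G) :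
  [set` H]%classic = setT -> strongly_quasiconvex R H.
Proof.
move=> HT A finA genA K C K1 C0; exists 2%R => I f a b g h _ _ _ _ _ _ _ [t It <-].
exists (vertex R A (src (f t))); first by exists (src (f t)); rewrite // HT.
by apply: le_trans (cayley_dist_le genA _ _) _; rewrite word_distxx add0r.
Qed.

Local Open Scope classical_set_scope.

Theorem theorem1p5 (R : realType) (T : finType) (e : rel T)
    (e_sym : symmetric e) (e_irr : irreflexive e)
    (e_conn : forall x y : T, connect e x y)
    (H : groupClosed (racg e))
    (H_fg : finitely_generated [set` H]) (H_mal : malnormal H) :
  strongly_quasiconvex R H /\
  ([set` H] <> [set: racg e] -> virtually_free H /\ stable R H).
Proof.
have H_cent := malnormal_cent H_mal.
have [HT|HT] := pselect ([set` H] = [set: racg e])%classic.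
  by split=> //; exact: whole_strongly_quasiconvex.
have H_refl := malnormal_refl e_conn H_mal HT; split=> [|_].
  exact: (@subgroup_strongly_quasiconvex _ _ _ e_sym e_irr _ (racg_presentation e)).
split; last exact: (@subgroup_stable _ _ _ e_sym e_irr _ (racg_presentation e)).
apply: free_virtually_free.
exact: (@malnormal_free _ _ e_sym e_irr _ (racg_presentation e)).
Qed.
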